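(* Consider one step, from $\varsigma^\nu$ to $\varsigma^{\nu+1}=\varsigma^\nu+\Delta\varsigma^\nu$, of the fully discrete moving mesh DG scheme (third-order explicit TVD Runge-Kutta in pseudo-time) described in the context. If the element volume is updated according to \[ \begin{cases} |K^{\nu,(1)}| = |K^{\nu}|+\Delta \varsigma^\nu\, |K^{\nu}|\,\nabla\cdot\dot{\bm{X}}|_{K^{\nu}},\\[2pt] |K^{\nu,(2)}| = \frac34 |K^{\nu}|+\frac14\big(|K^{\nu,(1)}|+\Delta \varsigma^\nu\, |K^{\nu,(1)}|\,\nabla\cdot\dot{\bm{X}}|_{K^{\nu,(1)}}\big),\\[2pt] |K^{\nu+1}| = \frac13 |K^{\nu}|+\frac23\big(|K^{\nu,(2)}|+\Delta \varsigma^\nu\, |K^{\nu,(2)}|\,\nabla\cdot\dot{\bm{X}}|_{K^{\nu,(2)}}\big), \end{cases} \] then the scheme reproduces the uniform flow, i.e., $u^{\nu}\equiv 1$ implies $u^{\nu+1}\equiv 1$.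
   Context: Moving mesh. $\mathcal{D}\subset\mathbb{R}^d$ ($d=1,2$) is a bounded polygonal domain. $\mathcal{T}_h^{old}$, $\mathcal{T}_h^{new}$ are nonsingular simplicial meshes of $\mathcal{D}$ with the same number of elements and vertices and the same connectivity, with vertices $\bm{x}_i^{old}$, $\bm{x}_i^{new}$, $i=1,\dots,N_v$. For $\varsigma\in[0,1]$, $\mathcal{T}_h(\varsigma)$ is the mesh with the same connectivity and vertices $\bm{x}_i(\varsigma)=(1-\varsigma)\bm{x}_i^{old}+\varsigma\bm{x}_i^{new}$. The mesh velocity is $\dot{\bm{X}}(\bm{x},\varsigma)=\sum_i(\bm{x}_i^{new}-\bm{x}_i^{old})\phi_i(\bm{x},\varsigma)$, with $\phi_i$ the piecewise linear basis function of vertex $i$ on $\mathcal{T}_h(\varsigma)$, so that $\nabla\cdot\dot{\bm{X}}|_K$ is constant on each element $K$. The boundary of the domain does not move. DG space. $V_h^r(\varsigma)=\{v\in L^2(\mathcal{D}): v|_K\in P^r(K)\ \forall K\in\mathcal{T}_h(\varsigma)\}$, $r\ge1$, where $P^r(K)$ is the space of polynomials of degree at most $r$ on $K$. $\widehat K$ is the reference element and $F_K:\widehat K\to K$ the affine map. Spatial operator. For an edge $e\in\partial K$ with outward unit normal $\bm{n}^e_K$, $u_K^{in}$ is the value of $u$ on $K$, $u_K^{out}$ the value on the element $K'$ sharing $e$ with $K$, and $\dot{\bm{X}}^e$ the restriction of $\dot{\bm{X}}$ to $e$. The numerical flux (local Lax-Friedrichs) is \[F_e(u_K^{in},u_K^{out})=\tfrac12\Big(-(u_K^{in}+u_K^{out})\,\dot{\bm{X}}^e\cdot\bm{n}^e_K-\alpha_e(u_K^{out}-u_K^{in})\Big),\qquad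 \alpha_e=\max(|\dot{\bm{X}}^e\cdot\bm{n}_K^e|,|\dot{\bm{X}}^e\cdot\bm{n}_{K'}^e|),\] and it vanishes on the boundary of the domain. Set \[\mathcal{A}(u,v)|_K=\sum_{e\in\partial K}\int_e vF_e(u_K^{in},u_K^{out})\,ds+\int_K(u\dot{\bm{X}})\cdot\nabla v\,d\bm{x}.\] For $u\equiv1$ and $v=\hat v\circ F_K^{-1}$ the divergence theorem gives $\mathcal{A}(1,v)|_K=-\nabla\cdot\dot{\bm{X}}|_K\int_K v\,d\bm{x}=-\frac{|K|}{|\widehat K|}\,\nabla\cdot\dot{\bm{X}}|_K\int_{\widehat K}\hat v\,d\hat{\bm{x}}$. Fully discrete scheme. $K^\nu$, $K^{\nu,(1)}$, $K^{\nu,(2)}$, $K^{\nu+1}$ denote the same mesh element at pseudo-times $\varsigma^\nu$, $\varsigma^{\nu+1}$, $\varsigma^{\nu+\frac12}$, $\varsigma^{\nu+1}$ respectively; $u^\nu,u^{(1)},u^{(2)},u^{\nu+1}$ are the DG functions at the corresponding stages; for each $\hat v\in P^r(\widehat K)$ the test functions are $v^\nu=\hat v\circ F_{K^\nu}^{-1}$, $v^{\nu,(1)}=\hat v\circ F_{K^{\nu,(1)}}^{-1}$, $v^{\nu,(2)}=\hat v\circ F_{K^{\nu,(2)}}^{-1}$, $v^{\nu+1}=\hat v\circ F_{K^{\nu+1}}^{-1}$. For every element and every $\hat v$, \[ \begin{cases} \int_{K^{\nu,(1)}}u^{(1)}v^{\nu,(1)}d\bm{x}=\int_{K^\nu}u^\nu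 v^\nu d\bm{x}-\Delta\varsigma^\nu\mathcal{A}(u^\nu,v^\nu)|_{K^\nu},\\ \int_{K^{\nu,(2)}}u^{(2)}v^{\nu,(2)}d\bm{x}=\frac34\int_{K^\nu}u^\nu v^\nu d\bm{x}+\frac14\big(\int_{K^{\nu,(1)}}u^{(1)}v^{\nu,(1)}d\bm{x}-\Delta\varsigma^\nu\mathcal{A}(u^{(1)},v^{\nu,(1)})|_{K^{\nu,(1)}}\big),\\ \int_{K^{\nu+1}}u^{\nu+1}v^{\nu+1}d\bm{x}=\frac13\int_{K^\nu}u^\nu v^\nu d\bm{x}+\frac23\big(\int_{K^{\nu,(2)}}u^{(2)}v^{\nu,(2)}d\bm{x}-\Delta\varsigma^\nu\mathcal{A}(u^{(2)},v^{\nu,(2)})|_{K^{\nu,(2)}}\big). \end{cases} \] Element volume. The vertex coordinates and the volume $|K|$ of the element are updated at each Runge-Kutta stage. $|K|$ denotes the element volume used by the scheme at that stage, entering element integrals through the change of variables $\int_K g\,d\bm{x}=\frac{|K|}{|\widehat K|}\int_{\widehat K}g\circ F_K\,d\hat{\bm{x}}$ (including in the formula for $\mathcal{A}(1,v)|_K$ above). The update in the claim is the third-order Runge-Kutta scheme applied directly to the geometric conservation law $\frac{d}{d\varsigma}|K|=|K|\,\nabla\cdot\dot{\bm{X}}|_K$. The volume could alternatively be computed from the vertex coordinates; the two agree for $d=1$ but differ in two and higher dimensions.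
   Formalization: Edge integrals in A(u,v)|_K use the edge measure scaled by the scheme's volume |K| (geometric length if |K| is geometric), so the stated formula for A(1,v)|_K holds for d=2; the updated volumes are assumed nonzero. *)

(* Defs.v *)
From HB Require Import structures.
From mathcomp Require Import all_boot all_order all_algebra.
From mathcomp Require Import all_classical all_reals all_analysis.
(* Not imported: the notations of mpoly clash with those of mathcomp-analysis. *)
From mathcomp Require mpoly.

Set Implicit Arguments.
Unset Strict Implicit.
Unset Printing Implicit Defensive.

Import Order.TTheory GRing.Theory Num.Theory.
Import numFieldNormedType.Exports.

Local Open Scope classical_set_scope.
Local Open Scope ring_scope.

(* The space dimension is d = n.+1, so that facets have dimension n. *)

(** * Vector calculus *)

(* The library norm on row vectors is the sup norm; unit normals need the
   Euclidean one. *)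
Definition dot (R : realType) (d : nat) (a b : 'rV[R]_d) : R :=
  \sum_(k < d) a 0 k * b 0 k.

Definition enorm (R : realType) (d : nat) (a : 'rV[R]_d) : R :=
  Num.sqrt (dot a a).

Definition grad (R : realType) (d : nat) (f : 'rV[R]_d -> R) (x : 'rV[R]_d) :
    'rV[R]_d :=
  \row_(k < d) 'D_(delta_mx 0 k) f x.

Definition div (R : realType) (d : nat) (f : 'rV[R]_d -> 'rV[R]_d)
    (x : 'rV[R]_d) : R :=
  \sum_(k < d) 'D_(delta_mx 0 k) (fun y => f y 0 k) x.

(* Polynomial functions of total degree at most r. *)
Definition polynomial_le (R : realType) (d r : nat) (f : 'rV[R]_d -> R) : Prop :=
  exists2 p : mpoly.mpoly d R,
    forall m, mpoly.mcoeff m p != 0 -> (mpoly.mdeg m <= r)%N &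
    forall x, f x = mpoly.meval (x 0) p.

(** * Simplices *)

(* Integral of g over the simplex {y | 0 <= y_k, \sum_k y_k <= s} of R^d, as an
   iterated Lebesgue integral (evaluation at the single point if d = 0). *)
Fixpoint simplex_int (R : realType) (d : nat) (s : R) :
    ('rV[R]_d -> R) -> R :=
  match d with
  | 0 => fun g => g 0
  | d'.+1 => fun g =>
      \int[lebesgue_measure]_(t in `[0, s])
        simplex_int (s - t) (fun y : 'rV[R]_d' => g (row_mx t%:M y))
  end.

(* Integral over the reference simplex, and its measure 1/d!. *)
Definition ref_int (R : realType) (d : nat) (g : 'rV[R]_d -> R) : R :=
  simplex_int 1 g.

Definition ref_vol (R : realType) (d : nat) : R :=
  ref_int (fun _ : 'rV[R]_d => 1).

Definition edge_mx (R : realType) (k d : nat) (p : 'I_k.+1 -> 'rV[R]_d) :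
    'M[R]_(k, d) :=
  \matrix_(j < k) (p (lift ord0 j) - p ord0).

(* The affine map from the reference simplex of R^k to the simplex with
   vertices p. *)
Definition aff (R : realType) (k d : nat) (p : 'I_k.+1 -> 'rV[R]_d)
    (y : 'rV[R]_k) : 'rV[R]_d :=
  p ord0 + y *m edge_mx p.

Definition aff_inv (R : realType) (d : nat) (p : 'I_d.+1 -> 'rV[R]_d)
    (x : 'rV[R]_d) : 'rV[R]_d :=
  (x - p ord0) *m invmx (edge_mx p).

(* Barycentric coordinate of x relative to the vertex p i. *)
Definition bary (R : realType) (d : nat) (p : 'I_d.+1 -> 'rV[R]_d)
    (i : 'I_d.+1) (x : 'rV[R]_d) : R :=
  if unlift ord0 i is Some j then aff_inv p x 0 j
  else 1 - \sum_(j < d) aff_inv p x 0 j.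

Definition conv (R : realType) (d : nat) (V : finType) (x : V -> 'rV[R]_d)
    (S : {set V}) : set 'rV[R]_d :=
  [set y | exists w : V -> R,
     [/\ forall i, 0 <= w i, forall i, i \notin S -> w i = 0,
         \sum_i w i = 1 & y = \sum_i w i *: x i]].

(** * Domain and moving mesh *)

Definition polygonal_domain (R : realType) (n : nat) (D : set 'rV[R]_n.+1) :
    Prop :=
  [/\ D !=set0, open D, connected D, bounded_set D &
      exists (N : nat) (p : 'I_N -> 'I_n.+2 -> 'rV[R]_n.+1),
        D = (\bigcup_(i in [set: 'I_N]) conv (p i) [set: 'I_n.+2]%SET)°].

Record moving_mesh (R : realType) (n : nat) := MovingMesh {
  vtx : finType;
  elt : finType;
  conn : elt -> 'I_n.+2 -> vtx;
  xold : vtx -> 'rV[R]_n.+1;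
  xnew : vtx -> 'rV[R]_n.+1 }.

Definition xpos (R : realType) (n : nat) (T : moving_mesh R n) (s : R)
    (i : vtx T) : 'rV[R]_n.+1 :=
  (1 - s) *: xold i + s *: xnew i.

Definition corner (R : realType) (n : nat) (T : moving_mesh R n) (s : R)
    (K : elt T) (j : 'I_n.+2) : 'rV[R]_n.+1 :=
  xpos s (conn K j).

Definition verts (R : realType) (n : nat) (T : moving_mesh R n) (K : elt T) :
    {set vtx T} :=
  [set conn K j | j : 'I_n.+2]%SET.

Definition cell (R : realType) (n : nat) (T : moving_mesh R n) (s : R)
    (K : elt T) : set 'rV[R]_n.+1 :=
  conv (xpos s) (verts K).

(* Conforming nonsingular simplicial mesh of D: two distinct elements meet in
   the simplex (possibly empty) spanned by their common vertices. *)
Definition mesh_of (R : realType) (n : nat) (D : set 'rV[R]_n.+1)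
    (T : moving_mesh R n) (s : R) : Prop :=
  [/\ injective (@verts R n T),
      forall K : elt T, \det (edge_mx (corner s K)) != 0,
      forall K K' : elt T, K != K' ->
        cell s K `&` cell s K' = conv (xpos s) (verts K :&: verts K')%SET &
      closure D = \bigcup_(K in [set: elt T]) cell s K].

(* Facets (the edges e of an element when d = 2, its end points when d = 1)
   are numbered by the opposite local vertex. *)
Definition facet_verts (R : realType) (n : nat) (T : moving_mesh R n)
    (K : elt T) (i : 'I_n.+2) : {set vtx T} :=
  [set conn K (lift i j) | j : 'I_n.+1]%SET.

(* The element on the other side of a facet, with the number the facet has
   there; None for the facets on the boundary of the domain. *)
Definition neighbor (R : realType) (n : nat) (T : moving_mesh R n)
    (K : elt T) (i : 'I_n.+2) : option (elt T * 'I_n.+2) :=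
  [pick q : elt T * 'I_n.+2 |
     (q.1 != K) && (facet_verts q.1 q.2 == facet_verts K i)].

(* The gradient is constant in x, evaluated at a vertex. *)
Definition grad_bary (R : realType) (n : nat) (T : moving_mesh R n) (s : R)
    (K : elt T) (i : 'I_n.+2) : 'rV[R]_n.+1 :=
  grad (bary (corner s K) i) (corner s K ord0).

(* Outward unit normal: the barycentric coordinate i vanishes on facet i and
   is positive inside the element. *)
Definition normal (R : realType) (n : nat) (T : moving_mesh R n) (s : R)
    (K : elt T) (i : 'I_n.+2) : 'rV[R]_n.+1 :=
  - ((enorm (grad_bary s K i))^-1 *: grad_bary s K i).

(* Restriction to the element K of the piecewise linear basis function of the
   vertex i. *)
Definition hat (R : realType) (n : nat) (T : moving_mesh R n) (s : R)
    (K : elt T) (i : vtx T) (x : 'rV[R]_n.+1) : R :=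
  \sum_(j < n.+2 | conn K j == i) bary (corner s K) j x.

Definition velocity (R : realType) (n : nat) (T : moving_mesh R n) (s : R)
    (K : elt T) (x : 'rV[R]_n.+1) : 'rV[R]_n.+1 :=
  \sum_(i : vtx T) hat s K i x *: (xnew i - xold i).

(* The velocity is affine on K, so its divergence may be taken at any point. *)
Definition div_velocity (R : realType) (n : nat) (T : moving_mesh R n) (s : R)
    (K : elt T) : R :=
  div (velocity s K) (corner s K ord0).

(* The boundary of the domain does not move: mesh points may only slide
   along it. *)
Definition boundary_fixed (R : realType) (n : nat) (T : moving_mesh R n)
    (s : R) : Prop :=
  forall (K : elt T) (i : 'I_n.+2), neighbor K i = None ->
  forall x, conv (xpos s) (facet_verts K i) x ->
    dot (velocity s K x) (normal s K i) = 0.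

(** * The DG scheme *)

(* A DG function is given by one function per element, its restriction to that
   element; thus u K is the inner trace and u K' the outer trace on a facet
   shared by K and K'. *)
Definition dg_space (R : realType) (n : nat) (T : moving_mesh R n) (r : nat)
    (u : elt T -> 'rV[R]_n.+1 -> R) : Prop :=
  forall K, polynomial_le r (u K).

Definition uniform_one (R : realType) (n : nat) (T : moving_mesh R n) (s : R)
    (u : elt T -> 'rV[R]_n.+1 -> R) : Prop :=
  forall K x, cell s K x -> u K x = 1.

(* Below, m K is the volume |K| used by the scheme, which for d = 2 need not be
   the volume computed from the vertices. *)

Definition elt_int (R : realType) (n : nat) (T : moving_mesh R n) (s : R)
    (m : elt T -> R) (K : elt T) (g : 'rV[R]_n.+1 -> R) : R :=
  m K / ref_vol R n.+1 * ref_int (fun y => g (aff (corner s K) y)).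

(* The measure of facet i is d |K| / h, where the height h is the inverse of
   |grad lambda_i|. This is the change of variables from the reference facet
   when |K| / |ref K| is the Jacobian, and the geometric measure if m K is the
   geometric volume. It is what makes A(1, v) on K equal to
   - div X |K| / |ref K| \int_(ref K) v by the divergence theorem. *)
Definition facet_measure (R : realType) (n : nat) (T : moving_mesh R n) (s : R)
    (m : elt T -> R) (K : elt T) (i : 'I_n.+2) : R :=
  n.+1%:R * m K * enorm (grad_bary s K i).

Definition facet_int (R : realType) (n : nat) (T : moving_mesh R n) (s : R)
    (m : elt T -> R) (K : elt T) (i : 'I_n.+2) (g : 'rV[R]_n.+1 -> R) : R :=
  facet_measure s m K i / ref_vol R n *
  ref_int (fun y => g (aff (fun j : 'I_n.+1 => corner s K (lift i j)) y)).

Definition flux (R : realType) (n : nat) (T : moving_mesh R n) (s : R)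
    (u : elt T -> 'rV[R]_n.+1 -> R) (K : elt T) (i : 'I_n.+2)
    (x : 'rV[R]_n.+1) : R :=
  if neighbor K i is Some (K', i') then
    let X := velocity s K x in
    let alpha := Num.max `|dot X (normal s K i)| `|dot X (normal s K' i')| in
    2^-1 * (- (u K x + u K' x) * dot X (normal s K i)
            - alpha * (u K' x - u K x))
  else 0.

Definition opA (R : realType) (n : nat) (T : moving_mesh R n) (s : R)
    (m : elt T -> R) (u : elt T -> 'rV[R]_n.+1 -> R) (v : 'rV[R]_n.+1 -> R)
    (K : elt T) : R :=
  \sum_(i < n.+2) facet_int s m K i (fun x => v x * flux s u K i x)
  + elt_int s m K (fun x => dot (u K x *: velocity s K x) (grad v x)).

Definition test_fun (R : realType) (n : nat) (T : moving_mesh R n) (s : R)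
    (K : elt T) (vh : 'rV[R]_n.+1 -> R) (x : 'rV[R]_n.+1) : R :=
  vh (aff_inv (corner s K) x).

(* Stages 0, 1, 2, 3 live at the pseudo-times s, s + ds, s + ds / 2, s + ds. *)
Definition rk3_step (R : realType) (n : nat) (T : moving_mesh R n) (r : nat)
    (s ds : R) (m0 m1 m2 m3 : elt T -> R)
    (u0 u1 u2 u3 : elt T -> 'rV[R]_n.+1 -> R) : Prop :=
  forall (K : elt T) (vh : 'rV[R]_n.+1 -> R), polynomial_le r vh ->
  let mass t m u := elt_int t m K (fun x => u K x * test_fun t K vh x) in
  let A t m u := opA t m u (test_fun t K vh) K in
  [/\ mass (s + ds) m1 u1 = mass s m0 u0 - ds * A s m0 u0,
      mass (s + ds / 2) m2 u2 =
        3 / 4 * mass s m0 u0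
        + 1 / 4 * (mass (s + ds) m1 u1 - ds * A (s + ds) m1 u1) &
      mass (s + ds) m3 u3 =
        1 / 3 * mass s m0 u0
        + 2 / 3 * (mass (s + ds / 2) m2 u2 - ds * A (s + ds / 2) m2 u2)].

Definition gcl_update (R : realType) (n : nat) (T : moving_mesh R n)
    (s ds : R) (m0 m1 m2 m3 : elt T -> R) : Prop :=
  forall K : elt T,
  [/\ m1 K = m0 K + ds * m0 K * div_velocity s K,
      m2 K = 3 / 4 * m0 K
             + 1 / 4 * (m1 K + ds * m1 K * div_velocity (s + ds) K) &
      m3 K = 1 / 3 * m0 K
             + 2 / 3 * (m2 K + ds * m2 K * div_velocity (s + ds / 2) K)].

(* Main.v *)
(* Idea. Since the initial datum is 1, the local Lax-Friedrichs flux through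
   every facet reduces to - X . n (on the boundary of the domain both sides
   vanish because X . n does), and on the reference simplex the divergence
   theorem turns A(1, v) into - (div X) |K| / |ref K| times the integral of v.
   Hence each stage equation, tested with v, has right-hand side |K| / |ref K|
   times the integral of v, where |K| is exactly the updated volume; testing
   with v = u - 1 shows that the integral of (u - 1)^2 is zero.

   The divergence theorem is needed for polynomials only. On a monomial every
   integral over the reference simplex or one of its facets is an instance of
   Dirichlet's formula
     \int (s - \sum y)^a y^m dy =
       a! m! / (a + |m| + d)! * s^(a + |m| + d),
   which follows from the beta integral by induction on the dimension d. *)

Require Import Defs.
From HB Require Import structures.
From mathcomp Require Import all_boot all_order all_algebra.
From mathcomp Require Import all_classical all_reals all_analysis.
From mathcomp Require Import ring lra.
From mathcomp Require mpoly.
Import (canonicals) mpoly.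
Set Implicit Arguments.
Unset Strict Implicit.
Unset Printing Implicit Defensive.

Import Order.TTheory GRing.Theory Num.Theory.
Import numFieldNormedType.Exports.
Local Open Scope classical_set_scope.
Local Open Scope ring_scope.

(** * Polynomials in one variable and their integrals *)

Lemma integral_deriv (R : realType) (p : {poly R}) (a b : R) : a <= b ->
  \int[lebesgue_measure]_(t in `[a, b]) p^`().[t] = p.[b] - p.[a].
Proof.
rewrite le_eqVlt => /orP[/eqP <-|ab]; first by rewrite set_itv1 Rintegral_set1 subrr.
rewrite /Rintegral (@continuous_FTC2 _ _ (horner p)) //.
- by move=> x; apply: continuous_subspaceT => t; exact: continuous_horner.
- split; first by move=> x _; exact: derivable_horner.
  + by apply: cvg_at_right_filter; exact: continuous_horner.
  + by apply: cvg_at_left_filter; exact: continuous_horner.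
- by move=> x _; rewrite derivE.
Qed.

Lemma antideriv_exists (R : numFieldType) (p : {poly R}) : exists q, q^`() = p.
Proof.
(* The coefficient at [i = 0] is a division by zero, hence 0. *)
exists (\poly_(i < (size p).+1) (p`_i.-1 / i%:R)); apply/polyP => i.
rewrite coef_deriv coef_poly ltnS; case: ltnP => [_|/leq_sizeP -> //].
  by rewrite /= -[LHS]mulr_natr divfK // pnatr_eq0.
by rewrite mul0rn.
Qed.

(** Antiderivatives reduce this to the linearity of evaluation, with no integrability condition to
    check. *)
Lemma integral_horner_sum (R : realType) (I : Type) (r : seq I) (c : I -> R)
    (p : I -> {poly R}) (a b : R) : a <= b ->
  \int[lebesgue_measure]_(t in `[a, b]) (\sum_(i <- r) c i * (p i).[t]) =
  \sum_(i <- r) c i * \int[lebesgue_measure]_(t in `[a, b]) (p i).[t].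
Proof.
move=> ab; have /choice[q qE] i := antideriv_exists (p i).
transitivity (\int[lebesgue_measure]_(t in `[a, b])
    ((\sum_(i <- r) c i *: q i)^`()).[t]).
  apply: eq_Rintegral => t _; rewrite raddf_sum horner_sum.
  by apply: eq_bigr => i _; rewrite /= derivZ hornerZ qE.
rewrite integral_deriv // !horner_sum -sumrB; apply: eq_bigr => i _.
by rewrite -qE integral_deriv // !hornerZ mulrBr.
Qed.

(** The points [s / 2], [s / 3], ... of [rs] are [size p] distinct roots, too many for a nonzero
    [p]. *)
Lemma poly_eq0_itv (R : realFieldType) (p : {poly R}) (s : R) : 0 < s ->
  (forall t, 0 < t < s -> p.[t] = 0) -> p = 0.
Proof.
move=> s0 p0; apply/eqP; apply: contraT => pn0.
pose rs := [seq s / i.+2%:R | i <- iota 0 (size p)].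
have : all (root p) rs.
  apply/allP => _ /mapP[i _ ->]; apply/rootP/p0.
  by rewrite divr_gt0 //= ltr_pdivrMr // ltr_pMr // ltr1n.
have rs_uniq : uniq rs.
  rewrite map_inj_in_uniq ?iota_uniq // => i j _ _ /(mulfI (lt0r_neq0 s0)).
  by move/invr_inj/eqP; rewrite eqr_nat => /eqP[].
by move=> /(max_poly_roots pn0)/(_ rs_uniq); rewrite size_map size_iota ltnn.
Qed.

(** An antiderivative is nondecreasing on the interval and has equal values at its ends, so it is
    constant there, hence constant as a polynomial. *)
Lemma poly_eq0_integral (R : realType) (p : {poly R}) (s : R) : 0 < s ->
  (forall t, 0 <= t <= s -> 0 <= p.[t]) ->
  \int[lebesgue_measure]_(t in `[0, s]) p.[t] = 0 -> p = 0.
Proof.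
move=> s0 p_ge0; have [q qE] := antideriv_exists p.
rewrite -qE integral_deriv ?ltW // => qs0.
have q_mono a b : 0 <= a -> a <= b -> b <= s -> q.[a] <= q.[b].
  move=> a0 ab bs; rewrite -subr_ge0 -integral_deriv // qE.
  apply: Rintegral_ge0 => t /=; rewrite in_itv /= => /andP[at_ tb].
  by apply: p_ge0; rewrite (le_trans a0) // (le_trans tb).
suff : q - q.[0]%:P = 0 by move/subr0_eq => ->; rewrite derivC.
apply: (@poly_eq0_itv _ _ s) => // t /andP[t0 ts]; rewrite !hornerE.
apply/eqP; rewrite subr_eq0 eq_le (q_mono 0) ?(ltW ts) ?(ltW t0) // andbT.
by rewrite -(subr0_eq qs0) q_mono ?(ltW ts) ?(ltW t0).
Qed.

Lemma integral_beta (R : realType) (a b : nat) (s : R) : 0 <= s ->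
  \int[lebesgue_measure]_(t in `[0, s]) (t ^+ a * (s - t) ^+ b) =
  a`!%:R * b`!%:R / (a + b).+1`!%:R * s ^+ (a + b).+1.
Proof.
move=> s0; have f0 n : n`!%:R != 0 :> R by rewrite pnatr_eq0 -lt0n fact_gt0.
have n0 n : n.+1%:R != 0 :> R by rewrite pnatr_eq0.
(* Induction on a: the derivative of t^(a+1) (s - t)^(b+1) has integral 0. *)
pose B a b : {poly R} := 'X^a * (s%:P - 'X) ^+ b.
have BE a' b' t : (B a' b').[t] = t ^+ a' * (s - t) ^+ b' by rewrite /B !hornerE.
have dB a' b' : (B a'.+1 b'.+1)^`() = B a' b'.+1 *+ a'.+1 - B a'.+1 b' *+ b'.+1.
  rewrite /B derivM derivXn deriv_exp derivB derivC derivX sub0r mulN1r mulNrn.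
  by rewrite mulrN mulrnAl mulrnAr.
elim: a b => [|a IH] b.
  transitivity (\int[lebesgue_measure]_(t in `[0, s])
      ((- b.+1%:R^-1 *: B 0%N b.+1)^`()).[t]).
    apply: eq_Rintegral => t _; rewrite expr0 mul1r.
    rewrite /B expr0 mul1r derivZ deriv_exp derivB derivC derivX sub0r mulN1r.
    rewrite hornerZ mulNrn hornerN hornerMn mulrNN -[(_ ^+ _).[_] *+ _]mulr_natl.
    by rewrite mulrA mulVf // mul1r !hornerE.
  rewrite integral_deriv // !hornerZ !BE subrr expr0 subr0 !mul1r expr0n /= mulr0 sub0r.
  by rewrite mulNr opprK add0n factS natrM invfM mulrCA divff // mulr1.
have dI : \int[lebesgue_measure]_(t in `[0, s]) (B a.+1 b.+1)^`().[t] = 0.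
  by rewrite integral_deriv // !BE subrr !exprS !mul0r mulr0 subrr.
have : a.+1%:R * (\int[lebesgue_measure]_(t in `[0, s]) (t ^+ a * (s - t) ^+ b.+1)) =
    b.+1%:R * (\int[lebesgue_measure]_(t in `[0, s]) (t ^+ a.+1 * (s - t) ^+ b)).
  apply/eqP; rewrite -subr_eq0; apply/eqP; rewrite -[RHS]dI -mulNr.
  (* A two-term sum indexed by booleans, so that linearity comes from [integral_horner_sum]. *)
  pose c i := if i : bool then a.+1%:R : R else - b.+1%:R.
  pose q i := if i : bool then B a b.+1 else B a.+1 b.
  have := @integral_horner_sum R bool [:: true; false] c q 0 s s0.
  rewrite !big_cons !big_nil /= !addr0.
  under [\int[_]_(_ in _) (B a b.+1).[_]]eq_Rintegral do rewrite BE.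
  under [\int[_]_(_ in _) (B a.+1 b).[_]]eq_Rintegral do rewrite BE.
  move=> <-; apply: eq_Rintegral => t _.
  by rewrite big_cons big_cons big_nil addr0 dB hornerD hornerN
    !hornerMn /c mulNr !mulr_natl.
rewrite IH => H; apply: (mulfI (n0 b)); rewrite -H addnS addSn.
by rewrite !(factS a) !(factS b) !natrM; ring.
Qed.

(** * Integration of polynomials over simplices *)

Lemma eq_integral_itv (R : realType) (f g : R -> R) (a b : R) :
  (forall t : R, a <= t <= b -> f t = g t) ->
  \int[lebesgue_measure]_(t in `[a, b]) f t = \int[lebesgue_measure]_(t in `[a, b]) g t.
Proof. by move=> fg; apply: eq_Rintegral => t; rewrite inE /= in_itv /= => /fg. Qed.

Lemma row_mxE0 (R : nzRingType) (d : nat) (t : R) (y : 'rV[R]_d) :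
  (row_mx t%:M y : 'rV_d.+1) 0 ord0 = t.
Proof.
have -> : ord0 = lshift d (0 : 'I_1) :> 'I_(1 + d) by exact: val_inj.
by rewrite [LHS]row_mxEl mxE eqxx.
Qed.

Lemma row_mxES (R : nzRingType) (d : nat) (t : R) (y : 'rV[R]_d) (k : 'I_d) :
  (row_mx t%:M y : 'rV_d.+1) 0 (lift ord0 k) = y 0 k.
Proof.
have -> : lift ord0 k = rshift 1 k :> 'I_(1 + d) by exact: val_inj.
exact: row_mxEr.
Qed.

Lemma row_mx_decomp (R : nzRingType) (d : nat) (x : 'rV[R]_d.+1) :
  x = row_mx (x 0 ord0)%:M (\row_k x 0 (lift ord0 k)).
Proof.
apply/rowP => k; case: (unliftP ord0 k) => [j|] ->; first by rewrite row_mxES mxE.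
by rewrite row_mxE0.
Qed.

(** Traces and boundary conditions are known on cells only, so integrands have to be compared on the
    simplex alone. *)
Lemma simplex_int_ext (R : realType) (d : nat) (s : R) (f g : 'rV[R]_d -> R) :
  0 <= s ->
  (forall y : 'rV[R]_d, (forall k, 0 <= y 0 k) -> \sum_k y 0 k <= s -> f y = g y) ->
  simplex_int s f = simplex_int s g.
Proof.
elim: d s f g => [|d IH] s f g s0 fg.
  by apply: fg => [[]//|]; rewrite big_ord0.
apply: eq_integral_itv => t /andP[t0 ts].
apply: IH => [|y y0 ys]; first by rewrite subr_ge0.
apply: fg => [k|].
  case: (unliftP ord0 k) => [j|] ->; first by rewrite row_mxES.
  by rewrite row_mxE0.
rewrite big_ord_recl row_mxE0 -lerBrDl.
by under eq_bigr do rewrite row_mxES.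
Qed.

Lemma simplex_int_ge0 (R : realType) (d : nat) (s : R) (f : 'rV[R]_d -> R) :
  (forall y, 0 <= f y) -> 0 <= simplex_int s f.
Proof.
elim: d s f => [|d IH] s f f0 /=; first exact: f0.
by apply: Rintegral_ge0 => t _; exact: IH.
Qed.

(** The classical Dirichlet integral of [(1 - \sum_k y_k)^a y^m] over the unit simplex of dimension
    [d]. *)
Definition dirichlet (R : realType) (d : nat) (a : nat) (m : 'I_d -> nat) : R :=
  a`!%:R * (\prod_k (m k)`!)%:R / (a + \sum_k m k + d)`!%:R.

(** Slicing at height [t] turns each term into a multiple of a power of [t] times a power of
    [s - t], which the beta integral evaluates. The form with sums matters: linearity of
    [simplex_int] is itself deduced from this formula. *)
Lemma simplex_int_dirichlet (R : realType) (d : nat) (s : R) (I : Type)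
    (r : seq I) (c : I -> R) (a : I -> nat) (m : I -> 'I_d -> nat) : 0 <= s ->
  simplex_int s (fun y : 'rV[R]_d => \sum_(i <- r)
     c i * ((s - \sum_k y 0 k) ^+ a i * \prod_k y 0 k ^+ m i k)) =
  \sum_(i <- r)
     c i * (dirichlet R (a i) (m i) * s ^+ (a i + \sum_k m i k + d)).
Proof.
elim: d s c m => [|d IH] s c m s0.
  apply: eq_bigr => i _; rewrite /dirichlet !big_ord0 subr0 mulr1 !addn0 mulr1.
  by rewrite divff ?mul1r // pnatr_eq0 -lt0n fact_gt0.
pose m' i (k : 'I_d) := m i (lift ord0 k).
pose b i := (a i + \sum_k m' i k + d)%N.
pose p i : {poly R} := 'X^(m i ord0) * (s%:P - 'X) ^+ b i.
have pE i t : (p i).[t] = t ^+ m i ord0 * (s - t) ^+ b i by rewrite /p !hornerE.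
transitivity (\int[lebesgue_measure]_(t in `[0, s])
    \sum_(i <- r) (c i * dirichlet R (a i) (m' i)) * (p i).[t]).
  apply: eq_integral_itv => t /andP[t0 ts].
  transitivity (simplex_int (s - t) (fun y : 'rV[R]_d => \sum_(i <- r)
      (c i * t ^+ m i ord0) *
      ((s - t - \sum_k y 0 k) ^+ a i * \prod_k y 0 k ^+ m' i k))).
    congr simplex_int; apply/funext => y; apply: eq_bigr => i _.
    rewrite !big_ord_recl row_mxE0 opprD addrA.
    rewrite (eq_bigr (fun k => y 0 k)); last by move=> k _; exact: row_mxES.
    rewrite -!mulrA; congr (_ * _); rewrite mulrCA; congr (_ * (_ * _)).
    by apply: eq_bigr => k _; rewrite row_mxES.
  rewrite IH ?subr_ge0 //; apply: eq_bigr => i _.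
  by rewrite pE mulrACA.
rewrite integral_horner_sum //; apply: eq_bigr => i _.
under eq_Rintegral do rewrite pE.
rewrite integral_beta // -!mulrA; congr (_ * _).
rewrite /dirichlet !big_ord_recl.
have -> : (m i ord0 + b i).+1 =
    (a i + (m i ord0 + \sum_(k < d) m i (lift ord0 k)) + d.+1)%N.
  by rewrite addnS /b addnA addnCA.
(* The factorial of [b i] is the denominator of the inner Dirichlet integral and a numerator of the
   beta integral, so it cancels. *)
have b0 : (b i)`!%:R != 0 :> R by rewrite pnatr_eq0 -lt0n fact_gt0.
rewrite -/(b i) natrM !mulrA; congr (_ / _ * _).
by rewrite mulrAC divfK // mulrAC.
Qed.

(** * Polynomial functions and their degrees *)

Lemma polynomial_leW (R : realType) (d r r' : nat) (f : 'rV[R]_d -> R) :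
  (r <= r')%N -> polynomial_le r f -> polynomial_le r' f.
Proof. by move=> rr' [p pr pE]; exists p => // m /pr mr; apply: leq_trans rr'. Qed.

Lemma eq_polynomial_le (R : realType) (d r : nat) (f g : 'rV[R]_d -> R) :
  f =1 g -> polynomial_le r f -> polynomial_le r g.
Proof. by move=> /funext ->. Qed.

Lemma polynomial_le_cst (R : realType) (d r : nat) (c : R) :
  polynomial_le r (fun _ : 'rV[R]_d => c).
Proof.
exists (mpoly.mpolyC d c) => [m|x]; last by rewrite mpoly.mevalC.
rewrite mpoly.mcoeffC; case: (m =P _) => [-> _|_]; first by rewrite mpoly.mdeg0.
by rewrite mulr0 eqxx.
Qed.

Lemma polynomial_le_coord (R : realType) (d : nat) (k : 'I_d) :
  polynomial_le 1 (fun x : 'rV[R]_d => x 0 k).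
Proof.
exists (mpoly.mpolyX R (mpoly.mnm1 k)) => [m|x]; last by rewrite mpoly.mevalXU.
rewrite mpoly.mcoeffX; case: (_ =P m) => [<- _|_]; first by rewrite mpoly.mdeg1.
by rewrite eqxx.
Qed.

Lemma polynomial_leD (R : realType) (d r : nat) (f g : 'rV[R]_d -> R) :
  polynomial_le r f -> polynomial_le r g -> polynomial_le r (fun x => f x + g x).
Proof.
move=> [p pr pE] [q qr qE]; exists (p + q) => [m|x]; last first.
  by rewrite mpoly.mevalD pE qE.
rewrite mpoly.mcoeffD; have [pm0|pm0 _] := eqVneq (mpoly.mcoeff m p) 0.
  by rewrite pm0 add0r => /qr.
exact: pr.
Qed.

Lemma polynomial_leM (R : realType) (d r r' : nat) (f g : 'rV[R]_d -> R) :
  polynomial_le r f -> polynomial_le r' g ->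
  polynomial_le (r + r') (fun x => f x * g x).
Proof.
move=> [p pr pE] [q qr qE]; exists (p * q) => [m|x]; last first.
  by rewrite mpoly.mevalM pE qE.
rewrite -mpoly.mcoeff_msupp => /mpoly.msuppM_le/allpairsP[[m1 m2] /= [m1p m2q ->]].
by rewrite mpoly.mdegD leq_add ?pr ?qr // -mpoly.mcoeff_msupp.
Qed.

Lemma polynomial_le_sum (R : realType) (d r : nat) (I : Type) (s : seq I)
    (P : pred I) (f : I -> 'rV[R]_d -> R) :
  (forall i, P i -> polynomial_le r (f i)) ->
  polynomial_le r (fun x => \sum_(i <- s | P i) f i x).
Proof.
move=> fr; elim: s => [|i s IH].
  by apply: (eq_polynomial_le _ (polynomial_le_cst _ r 0)) => x; rewrite big_nil.
case Pi: (P i).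
  apply: eq_polynomial_le (polynomial_leD (fr i Pi) IH) => x.
  by rewrite big_cons Pi.
by apply: eq_polynomial_le IH => x; rewrite big_cons Pi.
Qed.

Lemma polynomial_leX (R : realType) (d r n : nat) (f : 'rV[R]_d -> R) :
  polynomial_le r f -> polynomial_le (r * n) (fun x => f x ^+ n).
Proof.
move=> fr; elim: n => [|n IH]; first exact: polynomial_le_cst.
rewrite mulnS; apply: eq_polynomial_le (polynomial_leM fr IH) => x.
by rewrite exprS.
Qed.

Lemma polynomial_le_prod (R : realType) (d n : nat) (r : 'I_n -> nat)
    (f : 'I_n -> 'rV[R]_d -> R) :
  (forall i, polynomial_le (r i) (f i)) ->
  polynomial_le (\sum_i r i) (fun x => \prod_i f i x).
Proof.
elim: n r f => [|n IH] r f fr.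
  rewrite big_ord0; under eq_fun do rewrite big_ord0.
  exact: polynomial_le_cst.
rewrite big_ord_recl.
apply: (eq_polynomial_le _
  (polynomial_leM (fr ord0) (IH _ (fun i => f (lift ord0 i)) _))).
  by move=> x; rewrite big_ord_recl.
by move=> i; exact: fr.
Qed.

(** Substituting coordinates of degree at most 1 sends a monomial [m] to a polynomial of degree at
    most [mdeg m]. *)
Lemma polynomial_le_comp (R : realType) (d e r : nat) (f : 'rV[R]_e -> R)
    (z : 'rV[R]_d -> 'rV[R]_e) :
  polynomial_le r f -> (forall k, polynomial_le 1 (fun x => z x 0 k)) ->
  polynomial_le r (f \o z).
Proof.
move=> [p pr pE] zr.
(* The filter on nonzero coefficients carries into the sum the condition under which the degree of
   [m] is bounded. *)
apply: (@eq_polynomial_le _ _ _ (fun x =>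
    \sum_(m <- mpoly.msupp p | mpoly.mcoeff m p != 0)
      mpoly.mcoeff m p * \prod_k (z x 0 k) ^+ mpoly.fun_of_multinom m k)).
  move=> x; rewrite /= pE mpoly.mevalE big_mkcond; apply: eq_bigr => m _.
  by case: eqP => // ->; rewrite mul0r.
apply: polynomial_le_sum => m /pr mr.
apply: (@polynomial_leW _ _ (0 + \sum_k 1 * mpoly.fun_of_multinom m k)%N).
  by rewrite add0n; under eq_bigr do rewrite mul1n; rewrite -mpoly.mdegE.
apply: polynomial_leM; first exact: polynomial_le_cst.
by apply: polynomial_le_prod => k; exact: polynomial_leX.
Qed.

Definition polynomial_fun (R : realType) (d : nat) (f : 'rV[R]_d -> R) : Prop :=
  exists r, polynomial_le r f.

Lemma polynomial_fun_cst (R : realType) (d : nat) (c : R) :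
  polynomial_fun (fun _ : 'rV[R]_d => c).
Proof. by exists 0%N; exact: polynomial_le_cst. Qed.

Lemma polynomial_funD (R : realType) (d : nat) (f g : 'rV[R]_d -> R) :
  polynomial_fun f -> polynomial_fun g -> polynomial_fun (fun x => f x + g x).
Proof.
move=> [r fr] [r' gr]; exists (maxn r r'); apply: polynomial_leD.
  by apply: polynomial_leW fr; exact: leq_maxl.
by apply: polynomial_leW gr; exact: leq_maxr.
Qed.

Lemma polynomial_funM (R : realType) (d : nat) (f g : 'rV[R]_d -> R) :
  polynomial_fun f -> polynomial_fun g -> polynomial_fun (fun x => f x * g x).
Proof. by move=> [r fr] [r' gr]; exists (r + r')%N; exact: polynomial_leM. Qed.

Lemma polynomial_fun_sum (R : realType) (d : nat) (I : Type) (s : seq I)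
    (f : I -> 'rV[R]_d -> R) :
  (forall i, polynomial_fun (f i)) -> polynomial_fun (fun x => \sum_(i <- s) f i x).
Proof.
move=> fP; elim: s => [|i s IH].
  by under eq_fun do rewrite big_nil; exact: polynomial_fun_cst.
by under eq_fun do rewrite big_cons; exact: polynomial_funD.
Qed.

Lemma polynomial_fun_meval (R : realType) (d : nat) (p : mpoly.mpoly d R) :
  polynomial_fun (fun x : 'rV[R]_d => mpoly.meval (x 0) p).
Proof.
exists (\max_(m <- mpoly.msupp p) mpoly.mdeg m)%N, p => // m.
by rewrite -mpoly.mcoeff_msupp => mp; exact: leq_bigmax_seq.
Qed.

Lemma polynomial_fun_monomials (R : realType) (d : nat) (f : 'rV[R]_d -> R) :
  polynomial_fun f -> exists r : seq (R * ('I_d -> nat)),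
    forall x, f x = \sum_(i <- r) i.1 * \prod_k x 0 k ^+ i.2 k.
Proof.
move=> [_ [p _ pE]].
exists [seq (mpoly.mcoeff m p, fun k => mpoly.fun_of_multinom m k) | m <- mpoly.msupp p].
by move=> x; rewrite pE mpoly.mevalE [RHS]big_map.
Qed.

(** * Linearity and definiteness of the simplex integral *)

Lemma simplex_int_monomials (R : realType) (d : nat) (s : R) (I : Type)
    (r : seq I) (c : I -> R) (m : I -> 'I_d -> nat) : 0 <= s ->
  simplex_int s (fun y : 'rV[R]_d => \sum_(i <- r) c i * \prod_k y 0 k ^+ m i k) =
  \sum_(i <- r) c i * (dirichlet R 0 (m i) * s ^+ (\sum_k m i k + d)).
Proof.
move=> s0; have := simplex_int_dirichlet r c (fun=> 0%N) m s0.
under eq_bigr do rewrite add0n; move=> <-; congr simplex_int.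
by apply/funext => y; apply: eq_bigr => i _; rewrite expr0 mul1r.
Qed.

(** Both functions are lists of monomials, and [c * f y + g y] is the concatenated list, integrated
    term by term with Dirichlet's formula. Integrability of the iterated integrals never comes
    up. *)
Lemma simplex_int_linear (R : realType) (d : nat) (s c : R)
    (f g : 'rV[R]_d -> R) : 0 <= s -> polynomial_fun f -> polynomial_fun g ->
  simplex_int s (fun y => c * f y + g y) =
  c * simplex_int s f + simplex_int s g.
Proof.
move=> s0 /polynomial_fun_monomials[r fE] /polynomial_fun_monomials[r' gE].
have -> : f = fun x => \sum_(i <- r) i.1 * \prod_k x 0 k ^+ i.2 k.
  exact/funext.
have -> : g = fun x => \sum_(i <- r') i.1 * \prod_k x 0 k ^+ i.2 k.
  exact/funext.
pose t := [seq (c * i.1, i.2) | i <- r] ++ r'.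
transitivity (simplex_int s
    (fun x : 'rV[R]_d => \sum_(i <- t) i.1 * \prod_k x 0 k ^+ i.2 k)).
  congr simplex_int; apply/funext => x.
  rewrite big_cat big_map mulr_sumr; congr (_ + _).
  by apply: eq_bigr => i _; rewrite mulrA.
rewrite !simplex_int_monomials // big_cat big_map mulr_sumr; congr (_ + _).
by apply: eq_bigr => i _; rewrite /= -mulrA.
Qed.

Lemma simplex_intD (R : realType) (d : nat) (s : R) (f g : 'rV[R]_d -> R) :
  0 <= s -> polynomial_fun f -> polynomial_fun g ->
  simplex_int s (fun y => f y + g y) = simplex_int s f + simplex_int s g.
Proof.
move=> s0 fP gP; rewrite -[simplex_int s f]mul1r -simplex_int_linear //.
by congr simplex_int; apply/funext => y; rewrite mul1r.
Qed.

Lemma simplex_intZ (R : realType) (d : nat) (s c : R) (f : 'rV[R]_d -> R) :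
  0 <= s -> polynomial_fun f ->
  simplex_int s (fun y => c * f y) = c * simplex_int s f.
Proof.
move=> s0 fP; have P0 := polynomial_fun_cst d (0 : R).
have := simplex_int_linear c s0 fP P0.
have -> : simplex_int s (fun _ : 'rV[R]_d => 0) = 0.
  have := simplex_intD s0 P0 P0; under eq_fun do rewrite addr0.
  by move/eqP; rewrite -subr_eq0 opprD addrA subrr sub0r oppr_eq0 => /eqP.
by under eq_fun do rewrite addr0; rewrite addr0.
Qed.

Lemma simplex_int_sum (R : realType) (d : nat) (s : R) (I : Type) (r : seq I)
    (f : I -> 'rV[R]_d -> R) : 0 <= s -> (forall i, polynomial_fun (f i)) ->
  simplex_int s (fun y => \sum_(i <- r) f i y) = \sum_(i <- r) simplex_int s (f i).
Proof.
move=> s0 fP; elim: r => [|i r IH].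
  rewrite big_nil; under eq_fun do rewrite big_nil.
  have := simplex_intZ 0 s0 (polynomial_fun_cst d (0 : R)).
  by under eq_fun do rewrite mul0r; rewrite mul0r.
rewrite big_cons -IH -simplex_intD //; last exact: polynomial_fun_sum.
by congr simplex_int; apply/funext => y; rewrite big_cons.
Qed.

(* For fixed t, a slice of f at height t is a nonnegative polynomial whose
   integral is a polynomial in t; the latter is zero, so the slices
   with 0 < t < s vanish, and f itself is polynomial in t. *)
Lemma simplex_int_eq0 (R : realType) (d : nat) (s : R) (f : 'rV[R]_d -> R) :
  0 < s -> polynomial_fun f -> (forall y, 0 <= f y) -> simplex_int s f = 0 ->
  forall y, f y = 0.
Proof.
elim: d s f => [|d IH] s f s0 fP f_ge0 /= If0 y; first by rewrite (thinmx0 y).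
have [r fE] := polynomial_fun_monomials fP.
have fE' t z : f (row_mx t%:M z) = \sum_(i <- r)
    i.1 * t ^+ i.2 ord0 * \prod_k z 0 k ^+ i.2 (lift ord0 k).
  rewrite fE; apply: eq_bigr => i _; rewrite big_ord_recl row_mxE0 mulrA.
  by congr (_ * _); apply: eq_bigr => k _; rewrite row_mxES.
have sliceP t : polynomial_fun (fun z : 'rV[R]_d => f (row_mx t%:M z)).
  under eq_fun do rewrite fE'; apply: polynomial_fun_sum => i.
  apply: polynomial_funM; first exact: polynomial_fun_cst.
  eexists; apply: polynomial_le_prod => k.
  exact/polynomial_leX/polynomial_le_coord.
pose m (i : R * ('I_d.+1 -> nat)) (k : 'I_d) : nat := i.2 (lift ord0 k).
(* The integral of the slice at height [t], written as a polynomial in [t] by Dirichlet's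
   formula. *)
pose h : {poly R} := \sum_(i <- r) (i.1 * dirichlet R 0 (m i)) *:
  ('X^(i.2 ord0) * (s%:P - 'X) ^+ (\sum_k m i k + d)).
have hE t : t <= s -> simplex_int (s - t) (fun z => f (row_mx t%:M z)) = h.[t].
  move=> ts; under eq_fun do rewrite fE'.
  rewrite simplex_int_monomials ?subr_ge0 // horner_sum; apply: eq_bigr => i _.
  rewrite hornerZ hornerM hornerXn horner_exp hornerD hornerN hornerC hornerX.
  by rewrite mulrACA.
have h0 : h = 0.
  apply: (poly_eq0_integral s0) => [t /andP[_ ts]|].
    by rewrite -hE //; exact: simplex_int_ge0.
  by rewrite -[RHS]If0; apply: eq_integral_itv => t /andP[_ ts]; rewrite hE.
have f0 t z : 0 < t < s -> f (row_mx t%:M z) = 0.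
  move=> /andP[t0 ts]; apply: (IH (s - t) (fun z => f (row_mx t%:M z))) => //.
    by rewrite subr_gt0.
  by rewrite hE ?ltW // h0 horner0.
(* The point [y] is arbitrary, possibly outside the simplex: for fixed [z], [q] vanishes at all
   heights between 0 and [s], hence identically. *)
rewrite (row_mx_decomp y); set t0 := y _ _; set z : 'rV_d := \row_k _.
pose q : {poly R} := \sum_(i <- r)
  (i.1 * \prod_k z 0 k ^+ i.2 (lift ord0 k)) *: 'X^(i.2 ord0).
have qE t : f (row_mx t%:M z) = q.[t].
  rewrite fE' horner_sum; apply: eq_bigr => i _.
  by rewrite hornerZ hornerXn mulrAC.
rewrite qE (_ : q = 0) ?horner0 //.
by apply: (poly_eq0_itv s0) => t ts; rewrite -qE f0.
Qed.

Lemma ref_volE (R : realType) (d : nat) : ref_vol R d = d`!%:R^-1.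
Proof.
have := @simplex_int_monomials R d 1 unit [:: tt] (fun=> 1) (fun _ _ => 0%N) ler01.
under eq_fun do rewrite big_seq1 big1 // mulr1.
rewrite /ref_vol /ref_int => ->; rewrite big_seq1 mul1r expr1n mulr1 /dirichlet.
by rewrite !big1 // mul1r mul1r.
Qed.

(** * Directional derivatives of affine and polynomial functions *)

Lemma is_derive_affine (R : realType) (V : normedModType R) (f : V -> R)
    (x v : V) (c : R) : (forall h, f (h *: v + x) = f x + h * c) ->
  is_derive x v f c.
Proof.
move=> fE.
(* The difference quotient equals [c] at every nonzero step. *)
have cvg_c : h^-1 *: ((f \o shift x) (h *: v) - f x) @[h --> (0 : R)^'] --> c.
  apply/cvg_ballP => e e0; near=> h.
  rewrite /= fE addrAC subrr add0r scalerA mulVf ?scale1r; first exact: ballxx.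
  by near: h; exact: nbhs_dnbhs_neq.
by apply: DeriveDef; [exact: cvgP cvg_c|exact: cvg_lim cvg_c].
Unshelve. all: by end_near. Qed.

Lemma is_derive_mul (R : realType) (V : normedModType R) (f g : V -> R)
    (x v : V) (df dg : R) : is_derive x v f df -> is_derive x v g dg ->
  is_derive x v (fun y => f y * g y) (df * g x + f x * dg).
Proof.
move=> fd gd; apply: (is_derive_eq (is_deriveM fd gd)).
by rewrite addrC [df * _]mulrC.
Qed.

Lemma is_derive_add (R : realType) (V : normedModType R) (f g : V -> R)
    (x v : V) (df dg : R) : is_derive x v f df -> is_derive x v g dg ->
  is_derive x v (fun y => f y + g y) (df + dg).
Proof. by move=> fd gd; exact: is_deriveD. Qed.

Lemma is_derive_bigsum (R : realType) (V : normedModType R) (I : Type) (r : seq I)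
    (f : I -> V -> R) (x v : V) (df : I -> R) :
  (forall i, is_derive x v (f i) (df i)) ->
  is_derive x v (fun y => \sum_(i <- r) f i y) (\sum_(i <- r) df i).
Proof.
move=> fd; elim: r => [|i r IH].
  by rewrite big_nil; under eq_fun do rewrite big_nil; exact: is_derive_cst.
by rewrite big_cons; under eq_fun do rewrite big_cons; exact: is_derive_add.
Qed.

(** A chain rule linking analytic derivatives to the formal [mderiv]. It holds for constants and
    variables and passes to products and sums, which generate all polynomials. *)
Lemma is_derive_meval (R : realType) (V : normedModType R) (e : nat)
    (z : V -> 'rV[R]_e) (dz : 'I_e -> R) (x v : V) (p : mpoly.mpoly e R) :
  (forall j, is_derive x v (fun y => z y 0 j) (dz j)) ->
  is_derive x v (fun y => mpoly.meval (z y 0) p)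
    (\sum_j dz j * mpoly.meval (z x 0) (mpoly.mderiv j p)).
Proof.
move=> zd.
pose P q := is_derive x v (fun y => mpoly.meval (z y 0) q)
    (\sum_j dz j * mpoly.meval (z x 0) (mpoly.mderiv j q)).
have PC c : P (mpoly.mpolyC e c).
  rewrite /P; under eq_fun do rewrite mpoly.mevalC.
  by apply: is_derive_eq; rewrite big1 // => j _; rewrite mpoly.mderivC mpoly.meval0 mulr0.
have PM q1 q2 : P q1 -> P q2 -> P (q1 * q2).
  move=> d1 d2; rewrite /P; under eq_fun do rewrite mpoly.mevalM.
  apply: (is_derive_eq (is_derive_mul d1 d2)).
  rewrite mulr_suml mulr_sumr -big_split; apply: eq_bigr => j _ /=.
  by rewrite mpoly.mderivM mpoly.mevalD !mpoly.mevalM; ring.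
have PX j : P (mpoly.mpolyX R (mpoly.mnm1 j)).
  rewrite /P; under eq_fun do rewrite mpoly.mevalXU.
  apply: (is_derive_eq (zd j)); rewrite (bigD1 j) //= big1 => [|k kj].
    rewrite mpoly.mderivX mpoly.mevalZ mpoly.mnm1E eqxx mpoly.mevalX big1 ?addr0 ?mulr1 //.
    by move=> k _; rewrite mpoly.mnmBE subnn expr0.
  by rewrite mpoly.mderivX mpoly.mevalZ mpoly.mnm1E eq_sym (negbTE kj) mul0r mulr0.
have P1 : P 1 by rewrite -(mpoly.mpolyC1); exact: PC.
elim/mpoly.mpolyind: p => [|c m p _ _ IH].
  by rewrite -/(P 0) -(mpoly.mpolyC0); exact: PC.
rewrite -/(P _); have Pm : P (c *: mpoly.mpolyX R m).
  rewrite -mpoly.mul_mpolyC; apply: (PM _ _ (PC c)).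
  rewrite mpoly.mpolyXE_id; apply: (@big_ind _ P) => // k _.
  by elim: (mpoly.fun_of_multinom m k) => [//|n IHn];
    rewrite exprS; exact: (PM _ _ (PX k)).
rewrite /P; under eq_fun do rewrite mpoly.mevalD.
apply: (is_derive_eq (is_derive_add Pm IH)).
by rewrite -big_split; apply: eq_bigr => j _; rewrite /= mpoly.mderivD mpoly.mevalD mulrDr.
Qed.

(** * The divergence theorem on the reference simplex *)

(** [bary p i x] is convertible to [refbary (aff_inv p x) i], so facts about elements reduce to the
    reference simplex. *)
Definition refbary (R : realType) (d : nat) (y : 'rV[R]_d) (i : 'I_d.+1) : R :=
  if unlift ord0 i is Some j then y 0 j else 1 - \sum_(j < d) y 0 j.

(* The facets of the reference simplex are parametrized as in facet_int: the
   barycentric coordinate i is 0 and the others are those of y, in order. *)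
Definition facet_pt (R : realType) (n : nat) (i : 'I_n.+2) (y : 'rV[R]_n) :
    'rV[R]_n.+1 :=
  \row_j (if unlift i (lift ord0 j) is Some k then refbary y k else 0).

Lemma refbary0 (R : realType) (d : nat) (y : 'rV[R]_d) :
  refbary y ord0 = 1 - \sum_(j < d) y 0 j.
Proof. by rewrite /refbary unlift_none. Qed.

Lemma refbary_lift (R : realType) (d : nat) (y : 'rV[R]_d) (j : 'I_d) :
  refbary y (lift ord0 j) = y 0 j.
Proof. by rewrite /refbary liftK. Qed.

Lemma sum_refbary (R : realType) (d : nat) (y : 'rV[R]_d) :
  \sum_i refbary y i = 1.
Proof.
rewrite big_ord_recl; under eq_bigr do rewrite refbary_lift.
by rewrite refbary0 subrK.
Qed.

Lemma aff_refbary (R : realType) (k d : nat) (p : 'I_k.+1 -> 'rV[R]_d)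
    (y : 'rV[R]_k) : aff p y = \sum_i refbary y i *: p i.
Proof.
rewrite /aff big_ord_recl refbary0 scalerBl scale1r scaler_suml -addrA.
congr (_ + _); rewrite addrC -sumrB; apply/rowP => l; rewrite mxE summxE.
by apply: eq_bigr => j _; rewrite refbary_lift !mxE mulrBr.
Qed.

(** [facet_pt] prescribes every coordinate but that of vertex 0; the latter follows because both
    families of coordinates sum to 1. *)
Lemma refbary_facet_pt (R : realType) (n : nat) (i l : 'I_n.+2) (y : 'rV[R]_n) :
  refbary (facet_pt i y) l = if unlift i l is Some k then refbary y k else 0.
Proof.
case: (unliftP ord0 l) => [j|] ->; first by rewrite refbary_lift mxE.
have s1 : \sum_l (if unlift i l is Some k then refbary y k else 0) = 1.
  rewrite (bigD1_ord i) //= unlift_none add0r -[RHS](sum_refbary y).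
  by apply: eq_bigr => k _; rewrite liftK.
apply/eqP; rewrite refbary0 subr_eq -[X in X == _]s1 big_ord_recl; apply/eqP.
by congr (_ + _); apply: eq_bigr => j _; rewrite mxE.
Qed.

(** Vertex [i] has weight 0 at [facet_pt i y]. Facet integrals of the mesh thus become integrals
    over facets of the reference simplex, seen through the element map. *)
Lemma aff_facet (R : realType) (n d : nat) (p : 'I_n.+2 -> 'rV[R]_d)
    (i : 'I_n.+2) (y : 'rV[R]_n) :
  aff (fun j => p (lift i j)) y = aff p (facet_pt i y).
Proof.
rewrite !aff_refbary (bigD1_ord i) //= refbary_facet_pt unlift_none scale0r add0r.
by apply: eq_bigr => k _; rewrite refbary_facet_pt liftK.
Qed.

Lemma polynomial_le_refbary (R : realType) (d : nat) (i : 'I_d.+1) :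
  polynomial_le 1 (fun y : 'rV[R]_d => refbary y i).
Proof.
rewrite /refbary; case: unlift => [j|]; first exact: polynomial_le_coord.
apply: polynomial_leD; first exact: polynomial_le_cst.
under eq_fun do rewrite -sumrN.
apply: polynomial_le_sum => j _; under eq_fun do rewrite -mulN1r.
apply: (@polynomial_leM _ _ 0 1); first exact: polynomial_le_cst.
exact: polynomial_le_coord.
Qed.

Lemma polynomial_fun_comp (R : realType) (d e : nat) (f : 'rV[R]_e -> R)
    (z : 'rV[R]_d -> 'rV[R]_e) :
  polynomial_fun f -> (forall k, polynomial_le 1 (fun x => z x 0 k)) ->
  polynomial_fun (f \o z).
Proof. by move=> [r fr] z1; exists r; exact: polynomial_le_comp. Qed.

Lemma polynomial_le_facet_pt (R : realType) (n : nat) (i : 'I_n.+2) (j : 'I_n.+1) :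
  polynomial_le 1 (fun y : 'rV[R]_n => facet_pt i y 0 j).
Proof.
under eq_fun do rewrite mxE.
case: unlift => [k|]; first exact: polynomial_le_refbary.
exact: polynomial_le_cst.
Qed.

(* (n.+1)-dimensional multi-indices: this is the integral of y^m over every
   n-dimensional facet of the reference simplex on which y^m does not vanish. *)
Definition monomial_int (R : realType) (n : nat) (m : 'I_n.+1 -> nat) : R :=
  (\prod_j (m j)`!)%:R / (\sum_j m j + n)`!%:R.

(** On facet [i] a monomial containing the barycentric coordinate [i] vanishes; any other is a
    Dirichlet integrand in the remaining coordinates, with an integral that does not depend on the
    facet. *)
Lemma facet_int_meval (R : realType) (n : nat) (i : 'I_n.+2)
    (p : mpoly.mpoly n.+1 R) :
  ref_int (fun y => mpoly.meval (facet_pt i y 0) p) =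
  \sum_(m <- mpoly.msupp p) mpoly.mcoeff m p *
    (if unlift ord0 i is Some j then
       (mpoly.fun_of_multinom m j == 0)%N%:R else 1) *
    monomial_int R (mpoly.fun_of_multinom m).
Proof.
(* Exponents of all [n.+2] barycentric coordinates, that of vertex 0 being 0. *)
pose M (m : mpoly.multinom n.+1) (l : 'I_n.+2) : nat :=
  if unlift ord0 l is Some j then mpoly.fun_of_multinom m j else 0%N.
pose q m : R := mpoly.mcoeff m p * (M m i == 0)%N%:R.
transitivity (ref_int (fun y : 'rV[R]_n => \sum_(m <- mpoly.msupp p) q m *
   ((1 - \sum_k y 0 k) ^+ M m (lift i ord0) *
    \prod_k y 0 k ^+ M m (lift i (lift ord0 k))))).
  congr simplex_int; apply/funext => y; rewrite mpoly.mevalE.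
  apply: eq_bigr => m _; rewrite /q -mulrA; congr (_ * _).
  transitivity (\prod_l refbary (facet_pt i y) l ^+ M m l).
    rewrite [RHS]big_ord_recl /M unlift_none expr0 mul1r.
    by apply: eq_bigr => j _; rewrite liftK refbary_lift.
  rewrite (bigD1_ord i) //= refbary_facet_pt unlift_none expr0n; congr (_ * _).
  rewrite big_ord_recl refbary_facet_pt liftK refbary0; congr (_ * _).
  by apply: eq_bigr => k _; rewrite refbary_facet_pt liftK refbary_lift.
rewrite /ref_int simplex_int_dirichlet //; apply: eq_bigr => m _.
rewrite expr1n mulr1 /q; have -> : (if unlift ord0 i is Some j then
    (mpoly.fun_of_multinom m j == 0)%N%:R else 1) = (M m i == 0)%N%:R :> R.
  by rewrite /M; case: unlift.
case: (M m i =P 0)%N => Mi; last by rewrite !mulr0 !mul0r.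
rewrite !mulr1; congr (_ * _); rewrite /dirichlet /monomial_int.
have -> : (\sum_j mpoly.fun_of_multinom m j =
    M m (lift i ord0) + \sum_k M m (lift i (lift ord0 k)))%N.
  transitivity (\sum_l M m l)%N.
    rewrite [RHS]big_ord_recl /M unlift_none add0n.
    by apply: eq_bigr => j _; rewrite liftK.
  by rewrite (bigD1_ord i) //= Mi add0n big_ord_recl.
have -> : (\prod_j (mpoly.fun_of_multinom m j)`! =
    (M m (lift i ord0))`! * \prod_k (M m (lift i (lift ord0 k)))`!)%N.
  transitivity (\prod_l (M m l)`!)%N.
    rewrite [RHS]big_ord_recl /M unlift_none mul1n.
    by apply: eq_bigr => j _; rewrite liftK.
  by rewrite (bigD1_ord i) //= Mi mul1n big_ord_recl.
by rewrite natrM.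
Qed.

(** The factor produced by differentiation restores the factorial of the lowered exponent, and the
    extra dimension makes up for the lost degree: [monomial_int] appears again. *)
Lemma deriv_int_meval (R : realType) (n : nat) (j : 'I_n.+1)
    (p : mpoly.mpoly n.+1 R) :
  ref_int (fun y => mpoly.meval (y 0) (mpoly.mderiv j p)) =
  \sum_(m <- mpoly.msupp p) mpoly.mcoeff m p *
    (mpoly.fun_of_multinom m j != 0)%N%:R *
    monomial_int R (mpoly.fun_of_multinom m).
Proof.
pose m' (m : mpoly.multinom n.+1) :=
  mpoly.fun_of_multinom (mpoly.mnm_sub m (mpoly.mnm1 j)).
transitivity (ref_int (fun y : 'rV[R]_n.+1 => \sum_(m <- mpoly.msupp p)
   (mpoly.mcoeff m p * (mpoly.fun_of_multinom m j)%:R) * \prod_k y 0 k ^+ m' m k)).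
  congr simplex_int; apply/funext => y; rewrite {1}(mpoly.mpolyE p).
  rewrite (big_morph _ (mpoly.mderivD j) (mpoly.mderiv0 R j)).
  rewrite (big_morph _ (mpoly.mevalD _) (mpoly.meval0 _)); apply: eq_bigr => m _.
  by rewrite mpoly.mderivZ mpoly.mderivX !mpoly.mevalZ mpoly.mevalX mulrA.
rewrite /ref_int simplex_int_monomials //; apply: eq_bigr => m _.
rewrite expr1n mulr1 -!mulrA; congr (_ * _).
(* At exponent 0 the subtraction in [m'] is truncated, but the term then has coefficient 0. *)
case: (mpoly.fun_of_multinom m j =P 0)%N => mj; first by rewrite mj !mul0r.
have mjE : mpoly.fun_of_multinom m j = (m' m j).+1.
  by rewrite /m' mpoly.mnmBE mpoly.mnm1E eqxx subn1 prednK // lt0n; exact/eqP.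
have m'E k : k != j -> m' m k = mpoly.fun_of_multinom m k.
  by move=> kj; rewrite /m' mpoly.mnmBE mpoly.mnm1E eq_sym (negbTE kj) subn0.
rewrite mul1r /dirichlet /monomial_int mul1r add0n.
have -> : (\sum_k mpoly.fun_of_multinom m k = (\sum_k m' m k).+1)%N.
  rewrite (bigD1 j) //= [in RHS](bigD1 j) //= mjE addSn; congr (_ + _).+1.
  by apply: eq_bigr => k kj; rewrite m'E.
have -> : (\prod_k (mpoly.fun_of_multinom m k)`! =
    mpoly.fun_of_multinom m j * \prod_k (m' m k)`!)%N.
  rewrite (bigD1 j) //= [in RHS](bigD1 j) //= mulnA {1 2}mjE factS.
  by congr (_ * _)%N; apply: eq_bigr => k kj; rewrite m'E.
by rewrite natrM mulrA addSn addnS.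
Qed.

(** Facet 0 counts every monomial and the facet opposite to vertex [lift ord0 j] those free of the
    variable [j]; the difference keeps exactly the monomials that survive differentiation. *)
Lemma simplex_divergence (R : realType) (n : nat) (j : 'I_n.+1)
    (p : mpoly.mpoly n.+1 R) :
  ref_int (fun y => mpoly.meval (y 0) (mpoly.mderiv j p)) =
  ref_int (fun y => mpoly.meval (facet_pt ord0 y 0) p) -
  ref_int (fun y => mpoly.meval (facet_pt (lift ord0 j) y 0) p).
Proof.
rewrite deriv_int_meval !facet_int_meval -sumrB; apply: eq_bigr => m _.
rewrite liftK unlift_none -mulrBl -mulrBr; congr (_ * _ * _).
by case: (_ == _); rewrite ?subrr ?subr0.
Qed.

Lemma polynomial_le_interp (R : realType) (d e : nat) (a : 'I_d.+1 -> 'rV[R]_e)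
    (j : 'I_e) :
  polynomial_le 1 (fun z : 'rV[R]_d => (\sum_l refbary z l *: a l) 0 j).
Proof.
under eq_fun do rewrite summxE; apply: polynomial_le_sum => l _.
under eq_fun do rewrite mxE.
apply: (@polynomial_leM _ _ 1 0); first exact: polynomial_le_refbary.
exact: polynomial_le_cst.
Qed.

(* The directional derivative of the barycentric coordinate i along v. *)
Definition dbary (R : realType) (d : nat) (v : 'rV[R]_d) (i : 'I_d.+1) : R :=
  if unlift ord0 i is Some j then v 0 j else - \sum_(j < d) v 0 j.

Lemma is_derive_refbary (R : realType) (V : normedModType R) (d : nat)
    (z : V -> 'rV[R]_d) (dz : 'rV[R]_d) (x v : V) (i : 'I_d.+1) :
  (forall h, z (h *: v + x) = z x + h *: dz) ->
  is_derive x v (fun y => refbary (z y) i) (dbary dz i).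
Proof.
move=> zE; apply: is_derive_affine => h; rewrite zE.
case: (unliftP ord0 i) => [j|] ->; first by rewrite /dbary liftK !refbary_lift !mxE.
rewrite /dbary unlift_none !refbary0 mulrN -addrA -opprD mulr_sumr -big_split.
by congr (_ - _); apply: eq_bigr => j _; rewrite !mxE.
Qed.

(** Sum over [j] of [simplex_divergence] applied to [v] times the component [j] of the affine field
    [X]. The weight [dbary (X _) i] is the component of [X] along the inward gradient of coordinate
    [i], whence the signs; the sum of the [dbary (a l) l] is the divergence of [X]. *)
Lemma ref_divergence (R : realType) (n : nat) (p : mpoly.mpoly n.+1 R)
    (a : 'I_n.+2 -> 'rV[R]_n.+1) :
  let X (z : 'rV[R]_n.+1) := \sum_l refbary z l *: a l in
  \sum_i ref_int (fun y => mpoly.meval (facet_pt i y 0) p * dbary (X (facet_pt i y)) i) +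
  ref_int (fun z => \sum_j X z 0 j * mpoly.meval (z 0) (mpoly.mderiv j p)) =
  - (\sum_l dbary (a l) l) * ref_int (fun z => mpoly.meval (z 0) p).
Proof.
move=> X.
have XE z j : X z 0 j = \sum_l refbary z l * a l 0 j.
  by rewrite summxE; apply: eq_bigr => l _; rewrite mxE.
have XP j : polynomial_fun (fun z => X z 0 j) by exists 1%N; exact: polynomial_le_interp.
pose v (z : 'rV[R]_n.+1) := mpoly.meval (z 0) p.
pose dv j (z : 'rV[R]_n.+1) := mpoly.meval (z 0) (mpoly.mderiv j p).
have vP : polynomial_fun v by exact: polynomial_fun_meval.
have dvP j : polynomial_fun (dv j) by exact: polynomial_fun_meval.
(* The constant derivative of the component [j] of [X] in direction [j]. *)
pose c j := \sum_l dbary (delta_mx 0 j : 'rV[R]_n.+1) l * a l 0 j.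
pose f j z := v z * X z 0 j.
have fP j : polynomial_fun (f j) by exact: polynomial_funM.
have div_f j : ref_int (fun z => dv j z * X z 0 j + v z * c j) =
    ref_int (fun y => f j (facet_pt ord0 y)) -
    ref_int (fun y => f j (facet_pt (lift ord0 j) y)).
  have [_ [q _ qE]] := fP j.
  have fE : f j = fun z => mpoly.meval (z 0) q by exact/funext.
  have coordE (x w : 'rV[R]_n.+1) k : is_derive x w (fun y : 'rV[R]_n.+1 => y 0 k) (w 0 k).
    by apply: is_derive_affine => h; rewrite !mxE addrC.
  have mevalD z q' : is_derive z (delta_mx 0 j)
      (fun y : 'rV[R]_n.+1 => mpoly.meval (y 0) q')
      (mpoly.meval (z 0) (mpoly.mderiv j q')).
    have := is_derive_meval q' (coordE z (delta_mx 0 j)) => /is_derive_eq; apply.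
    rewrite (bigD1 j) //= big1 ?addr0 ?mxE ?eqxx ?mul1r // => k kj.
    by rewrite mxE (negbTE kj) mul0r.
  rewrite fE -simplex_divergence; congr simplex_int; apply/funext => z.
  have XD : is_derive z (delta_mx 0 j) (fun y => X y 0 j) (c j).
    under eq_fun do rewrite XE; apply: is_derive_bigsum => l.
    have dl : is_derive z (delta_mx 0 j) (fun y : 'rV[R]_n.+1 => refbary y l)
        (dbary (delta_mx 0 j : 'rV[R]_n.+1) l).
      by apply: (@is_derive_refbary _ _ _ id) => h; rewrite addrC.
    apply: (is_derive_eq (is_derive_mul dl (is_derive_cst (a l 0 j) z (delta_mx 0 j)))).
    by rewrite mulr0 addr0.
  (* The same derivative computed twice, formally from [q] and by the product rule. *)
  have := mevalD z q; rewrite -fE => D1.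
  have D2 := is_derive_mul (mevalD z p) XD.
  by rewrite -[RHS](@derive_val _ _ _ _ _ _ _ D1) -[LHS](@derive_val _ _ _ _ _ _ _ D2).
(* Linearity of [dbary], with [a l] expanded in the canonical basis. *)
have sum_c : \sum_j c j = \sum_l dbary (a l) l.
  rewrite /c exchange_big; apply: eq_bigr => l _.
  rewrite {2}/dbary; case: (unliftP ord0 l) => [k|] ->.
    rewrite (bigD1 k) //= big1 ?addr0 => [|j jk].
      by rewrite /dbary liftK mxE !eqxx mul1r.
    by rewrite /dbary liftK mxE eq_sym (negbTE jk) mul0r.
  rewrite -sumrN; apply: eq_bigr => j _.
  rewrite /dbary unlift_none (bigD1 j) //= big1 ?addr0 ?mxE ?eqxx ?mulN1r // => k kj.
  by rewrite mxE (negbTE kj).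
rewrite big_ord_recl.
have -> : ref_int (fun y => mpoly.meval (facet_pt ord0 y 0) p *
    dbary (X (facet_pt ord0 y)) ord0) =
    - \sum_j ref_int (fun y => f j (facet_pt ord0 y)).
  rewrite /ref_int -simplex_int_sum ?ler01 // => [|j]; last first.
    apply: (@polynomial_fun_comp _ _ _ (f j) (facet_pt ord0)) => // k.
    exact: polynomial_le_facet_pt.
  rewrite -mulN1r -simplex_intZ ?ler01 //; last first.
    apply: polynomial_fun_sum => j.
    apply: (@polynomial_fun_comp _ _ _ (f j) (facet_pt ord0)) => // k.
    exact: polynomial_le_facet_pt.
  congr simplex_int; apply/funext => y.
  by rewrite /dbary unlift_none mulN1r mulrN mulr_sumr.
have -> : ref_int (fun z => \sum_j X z 0 j * mpoly.meval (z 0) (mpoly.mderiv j p)) =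
    \sum_j ref_int (fun z => dv j z * X z 0 j).
  rewrite /ref_int -simplex_int_sum ?ler01 // => [|j]; last exact: polynomial_funM.
  congr simplex_int; apply/funext => z; apply: eq_bigr => j _.
  by rewrite mulrC.
rewrite -sumrN -!big_split -sum_c mulNr mulr_suml -sumrN.
apply: eq_bigr => j _ /=.
have -> : (fun y => mpoly.meval (facet_pt (lift ord0 j) y 0) p *
    dbary (X (facet_pt (lift ord0 j) y)) (lift ord0 j)) =
    fun y : 'rV[R]_n => f j (facet_pt (lift ord0 j) y).
  by apply/funext => y; rewrite /dbary liftK.
rewrite [- _ + _]addrC -opprB -div_f /ref_int.
rewrite simplex_intD ?ler01 //; last 2 first.
- exact: polynomial_funM.
- by apply: polynomial_funM => //; exact: polynomial_fun_cst.
have -> : (fun z => v z * c j) = fun z => c j * v z.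
  by apply/funext => z; rewrite mulrC.
by rewrite simplex_intZ ?ler01 // opprD addrAC addNr add0r.
Qed.

(** * Affine element maps and gradients of barycentric coordinates *)

Lemma aff_invK (R : realType) (d : nat) (p : 'I_d.+1 -> 'rV[R]_d) (y : 'rV[R]_d) :
  edge_mx p \in unitmx -> aff_inv p (aff p y) = y.
Proof. by move=> pU; rewrite /aff_inv /aff addrAC subrr add0r mulmxK. Qed.

Lemma affK (R : realType) (d : nat) (p : 'I_d.+1 -> 'rV[R]_d) (x : 'rV[R]_d) :
  edge_mx p \in unitmx -> aff p (aff_inv p x) = x.
Proof. by move=> pU; rewrite /aff /aff_inv mulmxKV // addrC subrK. Qed.

Lemma aff_inv_affine (R : realType) (d : nat) (p : 'I_d.+1 -> 'rV[R]_d)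
    (x v : 'rV[R]_d) (h : R) :
  aff_inv p (h *: v + x) = aff_inv p x + h *: (v *m invmx (edge_mx p)).
Proof. by rewrite /aff_inv -addrA mulmxDl -scalemxAl [LHS]addrC. Qed.

Lemma is_derive_bary (R : realType) (d : nat) (p : 'I_d.+1 -> 'rV[R]_d)
    (i : 'I_d.+1) (x v : 'rV[R]_d) :
  is_derive x v (bary p i) (dbary (v *m invmx (edge_mx p)) i).
Proof.
by apply: (@is_derive_refbary _ _ _ (aff_inv p)) => h; exact: aff_inv_affine.
Qed.

Lemma row_delta (R : nzRingType) (d m : nat) (k : 'I_d) (A : 'M[R]_(d, m)) j :
  (delta_mx 0 k *m A : 'rV_m) 0 j = A k j.
Proof. by rewrite -rowE mxE. Qed.

(** Moves normal components to the reference simplex: differentiating along [v] on the element is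
    differentiating along its pullback by the edge matrix. *)
Lemma dot_grad_bary (R : realType) (d : nat) (p : 'I_d.+1 -> 'rV[R]_d)
    (i : 'I_d.+1) (x v : 'rV[R]_d) :
  dot v (grad (bary p i) x) = dbary (v *m invmx (edge_mx p)) i.
Proof.
rewrite /dot /dbary; under eq_bigr => k _.
  rewrite mxE (@derive_val _ _ _ _ _ _ _ (is_derive_bary p i x (delta_mx 0 k))).
  over.
case: (unliftP ord0 i) => [j|] -> /=; rewrite ?liftK ?unlift_none.
  by rewrite mxE; apply: eq_bigr => k _; rewrite /dbary liftK row_delta.
rewrite -sumrN; under [RHS]eq_bigr do rewrite mxE -sumrN.
rewrite exchange_big; apply: eq_bigr => k _ /=.
rewrite /dbary unlift_none -sumrN mulr_sumr; apply: eq_bigr => j _.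
by rewrite row_delta mulrN.
Qed.

(** * Elements and facets of the mesh *)

Lemma refbary_ge0 (R : realType) (d : nat) (y : 'rV[R]_d) (i : 'I_d.+1) :
  (forall k, 0 <= y 0 k) -> \sum_k y 0 k <= 1 -> 0 <= refbary y i.
Proof. by rewrite /refbary => y0 y1; case: unlift => [j|]; rewrite ?subr_ge0. Qed.

(** Sums over all mesh vertices, as in [velocity] and [conv], become sums over local vertex numbers,
    grouped by the vertex they name. *)
Lemma sum_fibers (R : realType) (M : lmodType R) (V : finType) (k : nat)
    (f : 'I_k -> V) (b : 'I_k -> R) (x : V -> M) :
  \sum_v (\sum_(j < k | f j == v) b j) *: x v = \sum_j b j *: x (f j).
Proof.
rewrite (partition_big f predT) //=; apply: eq_bigr => v _.
by rewrite scaler_suml; apply: eq_bigr => j /eqP ->.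
Qed.

Lemma aff_in_conv (R : realType) (d k : nat) (V : finType) (x : V -> 'rV[R]_d)
    (f : 'I_k.+1 -> V) (S : {set V}) (y : 'rV[R]_k) :
  (forall j, f j \in S) -> (forall l, 0 <= y 0 l) -> \sum_l y 0 l <= 1 ->
  Defs.conv x S (aff (fun j => x (f j)) y).
Proof.
move=> fS y0 y1; exists (fun v => \sum_(j < k.+1 | f j == v) refbary y j); split.
- by move=> v; apply: sumr_ge0 => j _; exact: refbary_ge0.
- move=> v vS; rewrite big_pred0 // => j; apply: contraNF vS => /eqP <-.
  exact: fS.
- by rewrite -[RHS](sum_refbary y) [RHS](partition_big f predT).
- by rewrite aff_refbary sum_fibers.
Qed.

Lemma corner_in_cell (R : realType) (n : nat) (T : moving_mesh R n) (t : R)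
    (K : elt T) (y : 'rV[R]_n.+1) :
  (forall l, 0 <= y 0 l) -> \sum_l y 0 l <= 1 -> cell t K (aff (corner t K) y).
Proof. by apply: aff_in_conv => j; exact: imset_f. Qed.

(** [S] will be the facet itself for the boundary condition, and the vertices of either adjacent
    element for the two traces. *)
Lemma facet_in_conv (R : realType) (n : nat) (T : moving_mesh R n) (t : R)
    (K : elt T) (i : 'I_n.+2) (S : {set vtx T}) (y : 'rV[R]_n) :
  (facet_verts K i \subset S)%SET ->
  (forall l, 0 <= y 0 l) -> \sum_l y 0 l <= 1 ->
  Defs.conv (xpos t) S (aff (corner t K) (facet_pt i y)).
Proof.
move=> KS y0 y1; rewrite -(aff_facet (corner t K)).
apply: (aff_in_conv (xpos t) (f := fun j => conn K (lift i j))) => // j.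
by apply: (fintype.subsetP KS); exact: imset_f.
Qed.

Lemma facet_verts_sub (R : realType) (n : nat) (T : moving_mesh R n)
    (K : elt T) (i : 'I_n.+2) : (facet_verts K i \subset verts K)%SET.
Proof. by apply/fintype.subsetP => _ /imsetP[j _ ->]; exact: imset_f. Qed.

Lemma velocity_bary (R : realType) (n : nat) (T : moving_mesh R n) (t : R)
    (K : elt T) (x : 'rV[R]_n.+1) :
  velocity t K x =
  \sum_j bary (corner t K) j x *: (xnew (conn K j) - xold (conn K j)).
Proof. exact: (sum_fibers (conn K) _ (fun i => xnew i - xold i)). Qed.

(** The velocity interpolates the vertex displacements affinely; this is the constant appearing in
    [ref_divergence] for displacements pulled back to the reference simplex. *)
Lemma div_velocityE (R : realType) (n : nat) (T : moving_mesh R n) (t : R)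
    (K : elt T) :
  div_velocity t K = \sum_l dbary
    ((xnew (conn K l) - xold (conn K l)) *m invmx (edge_mx (corner t K))) l.
Proof.
rewrite /div_velocity /div.
transitivity (\sum_(k < n.+1) \sum_l dbary
    (delta_mx 0 k *m invmx (edge_mx (corner t K))) l *
    (xnew (conn K l) - xold (conn K l)) 0 k).
  apply: eq_bigr => k _.
  have -> : (fun y => velocity t K y 0 k) = fun y => \sum_l
      bary (corner t K) l y * (xnew (conn K l) - xold (conn K l)) 0 k.
    apply/funext => y; rewrite velocity_bary summxE.
    by apply: eq_bigr => l _; rewrite mxE.
  apply: (@derive_val _ _ _ _ _ _ _ _); apply: is_derive_bigsum => l.
  apply: (is_derive_eq (is_derive_mul (is_derive_bary _ l _ _)
    (is_derive_cst ((xnew (conn K l) - xold (conn K l)) 0 k) _ _))).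
  by rewrite mulr0 addr0.
rewrite exchange_big; apply: eq_bigr => l _.
(* The base point 0 is an arbitrary choice, the gradient being constant. *)
rewrite -(@dot_grad_bary _ _ _ _ 0) /dot; apply: eq_bigr => k _.
rewrite mulrC; congr (_ * _); rewrite mxE.
exact/esym/(@derive_val _ _ _ _ _ _ _ (is_derive_bary _ l _ _)).
Qed.

Lemma enorm_eq0_dot (R : realType) (d : nat) (v g : 'rV[R]_d) :
  enorm g = 0 -> dot v g = 0.
Proof.
have gg k : 0 <= g 0 k * g 0 k by rewrite -expr2 sqr_ge0.
move=> /eqP; rewrite sqrtr_eq0 => g0.
have {}g0 : dot g g = 0 by apply/eqP; rewrite eq_le g0 sumr_ge0.
rewrite /dot big1 // => k _.
have /eqP : g 0 k * g 0 k = 0 by apply: (psumr_eq0P (fun k _ => gg k) g0).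
by rewrite mulf_eq0 orbb => /eqP ->; rewrite mulr0.
Qed.

(** A zero gradient would kill [dbary _ i] in every direction, yet some basis vector of the
    reference simplex gives 1 or -1. *)
Lemma enorm_grad_bary_neq0 (R : realType) (n : nat) (T : moving_mesh R n)
    (t : R) (K : elt T) (i : 'I_n.+2) :
  edge_mx (corner t K) \in unitmx -> enorm (grad_bary t K i) != 0.
Proof.
move=> KU; apply/eqP => g0.
have dbary0 (w : 'rV[R]_n.+1) : dbary w i = 0.
  have := enorm_eq0_dot (w *m edge_mx (corner t K)) g0.
  by rewrite dot_grad_bary mulmxK.
case: (unliftP ord0 i) dbary0 => [j|] -> dbary0.
  have /eqP := dbary0 (delta_mx 0 j).
  by rewrite /dbary liftK mxE !eqxx oner_eq0.
have /eqP := dbary0 (delta_mx 0 0).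
rewrite /dbary unlift_none big_ord_recl mxE !eqxx big1 => [|k _]; last by rewrite mxE.
by rewrite addr0 oppr_eq0 oner_eq0.
Qed.

Lemma dot_normal (R : realType) (n : nat) (T : moving_mesh R n) (t : R)
    (K : elt T) (i : 'I_n.+2) (v : 'rV[R]_n.+1) :
  dot v (normal t K i) = - ((enorm (grad_bary t K i))^-1 *
    dbary (v *m invmx (edge_mx (corner t K))) i).
Proof.
rewrite -(dot_grad_bary _ _ (corner t K ord0)) -/(grad_bary t K i).
rewrite /dot mulr_sumr -sumrN; apply: eq_bigr => k _; rewrite !mxE.
by rewrite mulrN mulrCA.
Qed.

(** * One stage of the scheme on uniform data *)

Lemma elt_int_test (R : realType) (n : nat) (T : moving_mesh R n) (t : R)
    (m : elt T -> R) (K : elt T) (u vh : 'rV[R]_n.+1 -> R) :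
  edge_mx (corner t K) \in unitmx ->
  elt_int t m K (fun x => u x * test_fun t K vh x) =
  m K / ref_vol R n.+1 * ref_int (fun z => u (aff (corner t K) z) * vh z).
Proof.
move=> KU; rewrite /elt_int; congr (_ * simplex_int _ _).
by apply/funext => z; rewrite /test_fun aff_invK.
Qed.

Lemma flux_uniform (R : realType) (n : nat) (T : moving_mesh R n) (t : R)
    (u : elt T -> 'rV[R]_n.+1 -> R) (K : elt T) (i : 'I_n.+2) (y : 'rV[R]_n) :
  boundary_fixed T t -> uniform_one t u ->
  (forall l, 0 <= y 0 l) -> \sum_l y 0 l <= 1 ->
  let x := aff (corner t K) (facet_pt i y) in
  flux t u K i x = - dot (velocity t K x) (normal t K i).
Proof.
move=> bnd u1 y0 y1 x; rewrite /flux.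
case E: (neighbor K i) => [[K' i']|]; last first.
  by rewrite bnd ?oppr0 //; exact: facet_in_conv.
have uK : u K x = 1 by apply: u1; apply: facet_in_conv => //; exact: facet_verts_sub.
(* The neighbor has a facet with the same vertices, so [x] lies in its cell too. *)
have uK' : u K' x = 1.
  apply: u1; apply: facet_in_conv => //.
  move: E; rewrite /neighbor; case: pickP => // q /andP[_ /eqP KK'] [qE].
  by rewrite -KK' qE; exact: facet_verts_sub.
by rewrite uK uK' subrr mulr0 subr0 mulrA mulrN mulVf ?mulN1r // pnatr_eq0.
Qed.

(** [m K] factors out of every facet and element integral, so the identity holds for the volume
    carried by the scheme, not only for the geometric one. *)
Lemma opA_uniform (R : realType) (n r : nat) (T : moving_mesh R n) (t : R)
    (m : elt T -> R) (u : elt T -> 'rV[R]_n.+1 -> R) (K : elt T)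
    (vh : 'rV[R]_n.+1 -> R) :
  edge_mx (corner t K) \in unitmx -> boundary_fixed T t -> uniform_one t u ->
  polynomial_le r vh ->
  opA t m u (test_fun t K vh) K =
  - (m K * div_velocity t K) / ref_vol R n.+1 * ref_int vh.
Proof.
move=> KU bnd u1 [p _ pE].
(* [a] and [X] are the vertex displacements and the velocity pulled back to the reference
   simplex. *)
pose G := invmx (edge_mx (corner t K)).
pose a l := (xnew (conn K l) - xold (conn K l)) *m G.
pose X (z : 'rV[R]_n.+1) := \sum_l refbary z l *: a l.
have XE z : velocity t K (aff (corner t K) z) *m G = X z.
  rewrite velocity_bary mulmx_suml; apply: eq_bigr => l _.
  by rewrite -scalemxAl {1}/bary aff_invK.
(* The factor [n.+1] of [facet_measure] brings facets and elements to a common normalization. *)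
have vol : n.+1%:R / ref_vol R n = (ref_vol R n.+1)^-1.
  by rewrite !ref_volE !invrK factS natrM.
have XP j : polynomial_fun (fun z => X z 0 j) by exists 1%N; exact: polynomial_le_interp.
have vP : polynomial_fun (fun z : 'rV[R]_n.+1 => mpoly.meval (z 0) p).
  exact: polynomial_fun_meval.
have vhE : vh = fun z => mpoly.meval (z 0) p by exact/funext.
have facetE i : facet_int t m K i (fun x => test_fun t K vh x * flux t u K i x) =
    m K / ref_vol R n.+1 * ref_int (fun y =>
      mpoly.meval (facet_pt i y 0) p * dbary (X (facet_pt i y)) i).
  have dX : polynomial_fun (fun z => dbary (X z) i).
    rewrite /dbary; case: unlift => [j|] //.
    under eq_fun do rewrite -mulN1r.
    apply: polynomial_funM; first exact: polynomial_fun_cst.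
    exact: polynomial_fun_sum.
  rewrite /facet_int /facet_measure -vol /ref_int.
  rewrite (@simplex_int_ext _ _ _ _ (fun y => (enorm (grad_bary t K i))^-1 *
    (mpoly.meval (facet_pt i y 0) p * dbary (X (facet_pt i y)) i))) //; last first.
    move=> y y0 y1; rewrite aff_facet flux_uniform // dot_normal XE opprK.
    by rewrite /test_fun aff_invK // vhE mulrCA.
  rewrite simplex_intZ ?ler01 //; last first.
    apply: (polynomial_fun_comp (f := fun z => mpoly.meval (z 0) p * dbary (X z) i)).
      exact: polynomial_funM.
    by move=> k; exact: polynomial_le_facet_pt.
  rewrite !mulrA; congr (_ * _).
  (* The gradient norm in the facet measure cancels the one normalizing the normal. *)
  have g0 := enorm_grad_bary_neq0 i KU.
  by rewrite mulrAC mulfK // [m K * _]mulrC.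
have gradE x : grad (test_fun t K vh) x = \row_k \sum_j
    G k j * mpoly.meval (aff_inv (corner t K) x 0) (mpoly.mderiv j p).
  apply/rowP => k; rewrite !mxE.
  have -> : test_fun t K vh = fun x => mpoly.meval (aff_inv (corner t K) x 0) p.
    by apply/funext => y; rewrite /test_fun pE.
  apply: (@derive_val _ _ _ _ _ _ _ _); apply: is_derive_meval => j.
  apply: is_derive_affine => h.
  rewrite aff_inv_affine -(row_delta k G j) [LHS]mxE; congr (_ + _).
  by rewrite [LHS]mxE.
have volE : elt_int t m K
    (fun x => dot (u K x *: velocity t K x) (grad (test_fun t K vh) x)) =
    m K / ref_vol R n.+1 * ref_int (fun z =>
      \sum_j X z 0 j * mpoly.meval (z 0) (mpoly.mderiv j p)).
  rewrite /elt_int; congr (_ * _); apply: simplex_int_ext; rewrite ?ler01 // => z z0 z1.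
  rewrite u1; last exact: corner_in_cell.
  rewrite scale1r gradE aff_invK // -XE /dot.
  under [RHS]eq_bigr do rewrite mxE mulr_suml.
  rewrite exchange_big; apply: eq_bigr => k _ /=.
  by rewrite mxE mulr_sumr; apply: eq_bigr => j _; rewrite mulrA.
rewrite /opA volE; under eq_bigr do rewrite facetE.
rewrite -mulr_sumr -mulrDr ref_divergence div_velocityE vhE.
by rewrite -mulrN [LHS]mulrA; congr (_ * _); rewrite mulrAC.
Qed.

Lemma stage_uniform (R : realType) (n r : nat) (T : moving_mesh R n) (t : R)
    (m : elt T -> R) (u : elt T -> 'rV[R]_n.+1 -> R) (K : elt T) :
  edge_mx (corner t K) \in unitmx -> m K != 0 -> polynomial_le r (u K) ->
  (forall vh, polynomial_le r vh ->
    elt_int t m K (fun x => u K x * test_fun t K vh x) =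
    m K / ref_vol R n.+1 * ref_int vh) ->
  forall x, u K x = 1.
Proof.
move=> KU m0 ur uE x.
(* The error on the reference simplex, an admissible test function because affine pullback preserves
   the degree. *)
pose w z := u K (aff (corner t K) z) - 1.
have wr : polynomial_le r w.
  apply: polynomial_leD; last exact: polynomial_le_cst.
  apply: (polynomial_le_comp (f := u K)) => // k.
  by under eq_fun do rewrite aff_refbary; exact: polynomial_le_interp.
have wP : polynomial_fun w by exists r.
have mV0 : m K / ref_vol R n.+1 != 0.
  by rewrite mulf_neq0 // ref_volE invrK pnatr_eq0 -lt0n fact_gt0.
have ww : ref_int (fun z => w z * w z) = 0.
  have := uE w wr; rewrite elt_int_test // => /(mulfI mV0) H.
  apply: (addIr (ref_int w)); rewrite add0r -[RHS]H /ref_int -simplex_intD ?ler01 //.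
    by congr simplex_int; apply/funext => z; rewrite /w; ring.
  exact: polynomial_funM.
have ww0 z : w z * w z = 0.
  move: z; apply: (simplex_int_eq0 (s := 1)) => //; first exact: polynomial_funM.
  by move=> z; rewrite -expr2 sqr_ge0.
have /eqP := ww0 (aff_inv (corner t K) x).
by rewrite mulf_eq0 orbb /w affK // subr_eq0 => /eqP.
Qed.

Unset Implicit Arguments.

Theorem lemma2p1 (R : realType) (n r : nat) (hn : (n <= 1)%N) (hr : (1 <= r)%N)
    (D : set 'rV[R]_n.+1) (hD : polygonal_domain D)
    (T : moving_mesh R n)
    (hmesh : forall t : R, 0 <= t <= 1 -> mesh_of D T t)
    (hbnd : forall t : R, 0 <= t <= 1 -> boundary_fixed T t)
    (s ds : R) (hs : 0 <= s) (hds : 0 < ds) (hsds : s + ds <= 1)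
    (m0 m1 m2 m3 : elt T -> R)
    (hm : forall K, [/\ m1 K != 0, m2 K != 0 & m3 K != 0])
    (u0 u1 u2 u3 : elt T -> 'rV[R]_n.+1 -> R)
    (hu : [/\ dg_space r u0, dg_space r u1, dg_space r u2 & dg_space r u3])
    (hscheme : rk3_step r s ds m0 m1 m2 m3 u0 u1 u2 u3)
    (hgcl : gcl_update s ds m0 m1 m2 m3) :
  uniform_one s u0 -> uniform_one (s + ds) u3.
Proof.
move=> u0_1; case: hu => _ du1 du2 du3.
have t0 : 0 <= s <= 1 by lra.
have t1 : 0 <= s + ds <= 1 by lra.
have t2 : 0 <= s + ds / 2 <= 1 by lra.
have unit_edge (t : R) (K : elt T) : 0 <= t <= 1 -> edge_mx (corner t K) \in unitmx.
  by move=> ht; have [_ /(_ K) detK _ _] := hmesh t ht; rewrite unitmxE unitfE.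
have mass0 K vh : elt_int s m0 K (fun x => u0 K x * test_fun s K vh x) =
    m0 K / ref_vol R n.+1 * ref_int vh.
  rewrite elt_int_test ?unit_edge //; congr (_ * _).
  apply: simplex_int_ext => // z z0 z1; rewrite u0_1 ?mul1r //.
  exact: corner_in_cell.
(* The right-hand side of the stage is a combination of volumes times one common integral of [vh];
   [gcl_update] identifies that combination with [m1 K]. *)
have mass1 K vh : polynomial_le r vh ->
    elt_int (s + ds) m1 K (fun x => u1 K x * test_fun (s + ds) K vh x) =
    m1 K / ref_vol R n.+1 * ref_int vh.
  move=> hv; have [-> _ _] := hscheme K vh hv.
  rewrite (opA_uniform _ _ _ u0_1 hv) ?unit_edge //; last exact: hbnd.
  by rewrite mass0; have [-> _ _] := hgcl K; ring.
(* Uniformity has to be settled before the next stage, where [opA] is evaluated at [u1]. *)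
have u1_1 : uniform_one (s + ds) u1.
  move=> K x _; apply: (stage_uniform (unit_edge _ K t1) _ (du1 K) (mass1 K)).
  by have [] := hm K.
have mass2 K vh : polynomial_le r vh ->
    elt_int (s + ds / 2) m2 K (fun x => u2 K x * test_fun (s + ds / 2) K vh x) =
    m2 K / ref_vol R n.+1 * ref_int vh.
  move=> hv; have [_ -> _] := hscheme K vh hv.
  rewrite (opA_uniform _ _ _ u1_1 hv) ?unit_edge //; last exact: hbnd.
  by rewrite mass0 mass1 //; have [_ -> _] := hgcl K; ring.
have u2_1 : uniform_one (s + ds / 2) u2.
  move=> K x _; apply: (stage_uniform (unit_edge _ K t2) _ (du2 K) (mass2 K)).
  by have [] := hm K.
move=> K x _; apply: (stage_uniform (m := m3) (unit_edge _ K t1) _ (du3 K)).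
  by have [] := hm K.
move=> vh hv; have [_ _ ->] := hscheme K vh hv.
rewrite (opA_uniform _ _ _ u2_1 hv) ?unit_edge //; last exact: hbnd.
by rewrite mass0 mass2 //; have [_ _ ->] := hgcl K; ring.
Qed.
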